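(* Let $\boldsymbol{\gamma}\in\mathcal{A}$ and let $(\boldsymbol{R}^{[n]})_{n\ge0}$ be the sequence generated by the online algorithm $$\boldsymbol{R}^{[n+1]}=\boldsymbol{R}^{[n]}-a^{[n+1]}\bigl(A^{\mathrm T}\hat{\boldsymbol{\Pi}}^{[n+1]}-\boldsymbol{\gamma}\bigr),\qquad n\ge0,$$ with step sizes $a^{[n]}>0$ and observation frequencies $f^{[n]}>0$. Let $e^{[n]}\ge0$, $n\ge1$, be a sequence of real numbers. Suppose that (i) $\sum_{n=1}^\infty a^{[n]}=\infty$ and $\sum_{n=1}^\infty (a^{[n]})^2<\infty$; (ii) for all $c_2,c_3,c_4\in(0,\infty)$, $$\sum_{n=1}^{\infty}a^{[n]}\Bigl(\sum_{m=1}^{n-1}a^{[m]}\Bigr)\Bigl(e^{[n]}+\exp\Bigl(c_2\sum_{m=1}^n a^{[m]}-c_3\frac{(e^{[n]})^2}{f^{[n]}}\exp\Bigl(-c_4\sum_{m=1}^n a^{[m]}\Bigr)\Bigr)\Bigr)<\infty .$$ Then $\boldsymbol{R}^{[n]}$ converges to $\boldsymbol{r}^{\mathrm{opt}}$ with probability one as $n\to\infty$.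
   Context: Markov process: for each $\boldsymbol{r}\in\mathbb{R}^d$, $d>0$, consider an irreducible, reversible continuous-time Markov process on a finite state space $\Omega$ with generator matrix $Q=Q(\boldsymbol{r})$. There are $d$ configurable transition rates; the parameter $r_i$ is the logarithm of the $i$-th one, i.e. for each $i$ there are $x,y\in\Omega$ with $r_i=\ln Q_{x,y}$, while transition rates that are not configurable do not depend on $\boldsymbol r$. The steady-state distribution has the product form $$\boldsymbol{\pi}(\boldsymbol{r})=\frac{1}{Z(\boldsymbol{r})}\exp(A\boldsymbol{r}+\boldsymbol{b}),\qquad Z(\boldsymbol{r})=\mathbf{1}^{\mathrm T}\exp(A\boldsymbol{r}+\boldsymbol{b}),$$ where $A\in\mathbb{R}^{|\Omega|\times d}$ and $\boldsymbol{b}\in\mathbb{R}^{|\Omega|}$ are fixed, $\exp$ acts component-wise and $\mathbf 1$ is the all-ones vector. Target: $\mathcal{A}=\{A^{\mathrm T}\boldsymbol{\alpha}\mid\boldsymbol{\alpha}\in(0,1)^{|\Omega|},\ \boldsymbol{\alpha}^{\mathrm T}\mathbf{1}=1\}$. For $\boldsymbol{\gamma}\in\mathcal A$ write $\boldsymbol\gamma=A^{\mathrm T}\boldsymbol\alpha$ with such an $\boldsymbol\alpha$, and let $u(\boldsymbol r)=-\boldsymbol\alpha^{\mathrm T}\ln\boldsymbol\pi(\boldsymbol r)$, which is convex with gradient $A^{\mathrm T}\boldsymbol\pi(\boldsymbol r)-\boldsymbol\gamma$. It is assumed that $u$ has a unique critical point $\boldsymbol r^{\mathrm{opt}}\in\mathbb{R}^d$,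 called the optimal solution; it satisfies $A^{\mathrm T}\boldsymbol\pi(\boldsymbol r^{\mathrm{opt}})=\boldsymbol\gamma$. Algorithm: let $0=t^{[0]}<t^{[1]}<\cdots$ be deterministic times, $f^{[n]}=1/(t^{[n]}-t^{[n-1]})$, and let $\boldsymbol R^{[0]}\in\mathbb{R}^d$ be the initial parameters. During $[t^{[n]},t^{[n+1]}]$, $\{Z^{[n]}(t)\}$ is a time-homogeneous Markov process with generator $Q(\boldsymbol R^{[n]})$ that starts in state $Z^{[n-1]}(t^{[n]})$ (for $n=0$, in the initial state $X(0)$). At time $t^{[n+1]}$ one computes, for every $x\in\Omega$, $$\hat\Pi_x^{[n+1]}=\frac{1}{t^{[n+1]}-t^{[n]}}\int_{t^{[n]}}^{t^{[n+1]}}\mathbf 1[Z^{[n]}(t)=x]\,dt ,$$ and sets $\hat{\boldsymbol\Pi}^{[n+1]}=(\hat\Pi^{[n+1]}_x)_{x\in\Omega}$. Parameters are unconstrained (no truncation is applied). *)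

(* Defs.v *)
(* The finite state space is 'I_N; vectors are column matrices. *)
From HB Require Import structures.
From mathcomp Require Import all_boot all_order all_algebra.
From mathcomp Require Import all_classical all_reals all_analysis.

Set Implicit Arguments.
Unset Strict Implicit.
Unset Printing Implicit Defensive.
Import Order.TTheory GRing.Theory Num.Theory.
Import numFieldNormedType.Exports.
Local Open Scope classical_set_scope.
Local Open Scope ring_scope.

Section Chains.
Context {R : realType} {N : nat}.
Implicit Types (Q : 'M[R]_N) (p : 'cV[R]_N).

Definition generator Q : Prop :=
  (forall x y, x != y -> 0 <= Q x y) /\ (forall x, \sum_y Q x y = 0).

Definition irreducible Q : Prop :=
  forall x y, connect (fun i j => (i != j) && (0 < Q i j)) x y.

Definition probability_vector p : Prop :=
  (forall x, 0 <= p x 0) /\ \sum_x p x 0 = 1.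

Definition steady_state Q p : Prop := probability_vector p /\ p^T *m Q = 0.

(* detailed balance *)
Definition reversible Q p : Prop :=
  forall x y, p x 0 * Q x y = p y 0 * Q y x.

(* The matrix exponential, as a limit in 'M[R]_N; expmx (h *: Q) is the
   transition matrix over a time span h of the process with generator Q. *)
Definition expmx Q : 'M[R]_N :=
  limn (series (fun k : nat => (k`!%:R)^-1 *: Q ^+ k)).

End Chains.

Section Model.
Context {R : realType} {N d : nat}.
Variables (A : 'M[R]_(N, d)) (b : 'cV[R]_N).

Definition partition_function (r : 'cV[R]_d) : R :=
  ((const_mx 1 : 'cV[R]_N)^T *m map_mx expR (A *m r + b)) 0 0.

Definition product_form (r : 'cV[R]_d) : 'cV[R]_N :=
  (partition_function r)^-1 *: map_mx expR (A *m r + b).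

(* Off-diagonal rates only: the diagonal of a generator is determined by the
   other entries.  The transition x -> y is configured by r_i when r_i is the
   logarithm of its rate, whatever the value of r; several transitions may
   share the same parameter. *)
Definition configured_by (Q : 'cV[R]_d -> 'M[R]_N) (i : 'I_d) (x y : 'I_N) :
    Prop :=
  x != y /\ forall r, 0 < Q r x y /\ r i 0 = ln (Q r x y).

Record product_form_network (Q : 'cV[R]_d -> 'M[R]_N) : Prop := {
  pfn_generator : forall r, generator (Q r) ;
  pfn_irreducible : forall r, irreducible (Q r) ;
  pfn_reversible : forall r, reversible (Q r) (product_form r) ;
  pfn_steady_state : forall r, steady_state (Q r) (product_form r) ;
  pfn_configurable : forall i, exists x y, configured_by Q i x y ;
  pfn_fixed : forall x y, x != y ->
    (forall i, ~ configured_by Q i x y) -> forall r r', Q r x y = Q r' x y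
}.

Definition target_weights (gamma : 'cV[R]_d) : set 'cV[R]_N :=
  [set alpha : 'cV[R]_N | [/\ forall x, 0 < alpha x 0 < 1,
     (alpha^T *m (const_mx 1 : 'cV[R]_N)) 0 0 = 1 & gamma = A^T *m alpha]].

Definition target_set : set 'cV[R]_d :=
  [set gamma | target_weights gamma !=set0].

Definition objective (alpha : 'cV[R]_N) (r : 'cV[R]_d) : R :=
  - (alpha^T *m map_mx (@ln R) (product_form r)) 0 0.

End Model.

Definition critical_point {R : realType} {d : nat} (u : 'cV[R]_d -> R)
    (r : 'cV[R]_d) : Prop :=
  differentiable u r /\ 'd u r =1 (fun=> 0).

Section OnlineProcess.
Context {R : realType} {N d : nat} {disp : measure_display}
  {T : measurableType disp}.
Variables (P : probability T R) (t : nat -> R).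
Implicit Types (Z : nat -> R -> T -> 'I_N).

Definition observation_times : Prop :=
  t 0 = 0 /\ forall n, t n < t n.+1.

(* used for n >= 1 only *)
Definition frequency (n : nat) : R := (t n - t n.-1)^-1.

(* Z n is only meaningful on the n-th observation period
   [t n, t n.+1]. *)
Definition in_period (n : nat) (s : R) : Prop := t n <= s <= t n.+1.

Definition occupation Z (n : nat) (w : T) : 'cV[R]_N :=
  \col_x ((t n.+1 - t n)^-1 *
    \int[lebesgue_measure]_(s in `[t n, t n.+1])
      \1_[set s' | Z n s' w = x] s).

(* the events determined by everything observed up to time s, where s belongs
   to the n-th period *)
Definition history Z (n : nat) (s : R) : set (set T) :=
  <<s [set B | exists m v x, [/\ (m <= n)%N, in_period m v, v <= s &
                               B = [set w | Z m v w = x]]] >>.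

(* Z n is a Markov process with generator Q (Rn n): given the history up to
   time s, the conditional probability of Z n u = y is the entry
   (Z n s, y) of expmx ((u - s) *: Q (Rn n)).  Conditional probabilities are
   written as integrals over the events of the history, of which Rn n is a
   function once it is generated by the algorithm. *)
Record online_process (Q : 'cV[R]_d -> 'M[R]_N) (X0 : T -> 'I_N)
    (Z : nat -> R -> T -> 'I_N) (Rn : nat -> T -> 'cV[R]_d) : Prop := {
  op_measurable : forall n s x, in_period n s ->
    measurable [set w | Z n s w = x] ;
  op_right_continuous : forall n s w, t n <= s < t n.+1 ->
    \forall v \near s^'+, Z n v w = Z n s w ;
  op_init : forall w, Z 0 (t 0) w = X0 w ;
  op_start : forall n w, Z n.+1 (t n.+1) w = Z n (t n.+1) w ;
  op_markov : forall n s u H y,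
    in_period n s -> in_period n u -> s <= u -> history Z n s H ->
    (P (H `&` [set w | Z n u w = y]) =
     \int[P]_(w in H) (expmx ((u - s) *: Q (Rn n w)) (Z n s w) y)%:E)%E
}.

(* the estimate computed at time t n.+1 is occupation Z n *)
Definition online_algorithm (A : 'M[R]_(N, d)) (gamma r0 : 'cV[R]_d)
    (a : nat -> R) Z (Rn : nat -> T -> 'cV[R]_d) : Prop :=
  (forall w, Rn 0 w = r0) /\
  (forall n w, Rn n.+1 w =
     Rn n w - a n.+1 *: (A^T *m occupation Z n w - gamma)).

End OnlineProcess.

(* Main.v *)
Require Import Defs.
From mathcomp Require Import all_boot all_order all_algebra.
From mathcomp Require Import all_classical all_reals all_analysis.
From mathcomp Require Import measurable_realfun ring lra.
Import Order.TTheory GRing.Theory Num.Theory.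
Import numFieldNormedType.Exports.
Local Open Scope classical_set_scope.
Local Open Scope ring_scope.

(** The online algorithm is gradient descent on the convex objective, with the
gradient [A^T pi(r) - gamma] replaced by the noisy value [A^T Pi - gamma], where
[Pi] is the vector of observed occupation fractions.  Two facts make it
converge: the exact gradient pushes the iterates towards the optimum, and the
errors [Pi - pi(r)], weighted by the step sizes, are summable along the run.

The drift.  Put [v = A (r - ropt)].  Then [pi(r)] is [pi(ropt)] tilted by [exp
v], and the drift [<r - ropt, A^T pi(r) - gamma>] is the covariance of [v] and
[exp v] up to normalisation.  It dominates the spread of [v] ([tilt_gap]).  The
spread in turn dominates [|r - ropt|^2]: if [v] is constant then translation by
[r - ropt] does not change the objective, so that [r] is again a critical point
and uniqueness gives [r = ropt].  Hence the drift is at least [c |r - ropt|^2]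
on every bounded set ([mean_drift_coercive]).  With summable errors and [sum a =
oo], the deterministic recursion for [|Rn - ropt|^2] then tends to [0]
([perturbed_descent_cvg0]).

The errors.  The parameters move by at most a constant times [S n = a 1 + ... +
a n], so every positive transition rate during period [n] lies between [exp(- c
(1 + S n))] and [exp(c (1 + S n))].  The estimation error is controlled through
its second moment.  Let [phi] be the centred indicator of a state [x] and let
[g] solve the Poisson equation [Q g = phi].  The Markov property says that,
conditionally on the past, [g(Z_u) - g(Z_s)] is [(u - s) phi(Z_s)] up to [O((u -
s)^2)] ([potential_increment]), so integrals of [phi] along the path behave like
a bounded term plus a martingale, and their variance grows linearly
([lyapunov_growth]).  This gives [E (Pi_x - pi_x)^2 <= 4 max|g| f] with [f] the
observation frequency ([occupation_variance]).  The Dirichlet form bounds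
[max|g|] by [C exp(c S n)] ([deviation_growth]).

The summability hypothesis holds for all constants, and therefore the variance
bound suffices ([estimation_error_L1]).  If [4 max|g| f <= e^2] then [E |Pi_x -
pi_x| <= e] by the arithmetic-geometric mean inequality.  Otherwise [(e^2 / f)
exp(- c4 S)] is bounded for a suitable [c4], the exponential term of the
hypothesis is bounded below, and the trivial bound [1] on the error is at most a
constant times it.  So [sum a (1 + S) E |Pi - pi|] is finite, the series of
errors converges almost surely, and the deterministic recursion applies to
almost every path. *)

Set Implicit Arguments.
Unset Strict Implicit.
Unset Printing Implicit Defensive.

(** * A perturbed descent recursion *)

(** Coercivity is only available on bounded sets, but the recursion itself keeps
[D] below [D 0 + M], so one constant [c] serves for all [n].  Summing the
recursion bounds [sum a D]; as [sum a] diverges, [D] comes close to [0] at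
arbitrarily late times, and from such a time on it can grow by no more than the
tail of [sum eps]. *)
Lemma perturbed_descent_cvg0 (R : realType) (D a psi eps : nat -> R) (M : R) :
  (forall n, 0 <= D n) -> (forall n, 0 <= a n) -> (forall n, 0 <= eps n) ->
  (forall n, 0 <= psi n) ->
  (forall n, D n.+1 <= D n - a n * psi n + eps n) ->
  (forall B : R, exists2 c : R, 0 < c & forall n, D n <= B -> c * D n <= psi n) ->
  (forall n, \sum_(i < n) eps i <= M) ->
  (forall K, exists n, K < \sum_(i < n) a i) ->
  D n @[n --> \oo] --> 0.
Proof.
move=> D0 a0 eps0 psi0 rec growth sumeps suma.
have tele n m : (n <= m)%N ->
    D m + \sum_(n <= i < m) a i * psi i <= D n + \sum_(n <= i < m) eps i.
  move=> /subnK <-; elim: (m - n)%N => [|k IH]; first by rewrite add0n !big_geq ?addr0.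
  rewrite addSn !big_nat_recr ?leq_addl //=; have := rec (k + n)%N; lra.
have teleB n : D n + \sum_(0 <= i < n) a i * psi i <= D 0 + M.
  by apply: le_trans (tele 0 n _) _; rewrite ?lerD2l ?big_mkord.
have sumpsi0 n m : 0 <= \sum_(n <= i < m) a i * psi i.
  by apply: sumr_ge0 => i _; rewrite mulr_ge0.
have DB n : D n <= D 0 + M by apply: le_trans (teleB n); rewrite lerDl.
have [c c0 cD] := growth (D 0 + M).
have sumaD n : \sum_(i < n) a i * D i <= (D 0 + M) / c.
  rewrite ler_pdivlMr // mulr_suml.
  apply: le_trans (_ : \sum_(i < n) a i * psi i <= _).
    by apply: ler_sum => i _; rewrite -mulrA ler_wpM2l // mulrC cD.
  by rewrite -(big_mkord xpredT (fun i => a i * psi i)); have := teleB n; have := D0 n; lra.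
apply/cvgrPdist_le => /= eta eta0.
pose E n := \sum_(i < n) eps i.
have ndE : {homo E : n m / (n <= m)%N >-> n <= m}.
  by apply/nondecreasing_seqP => n; rewrite /E big_ord_recr /= lerDl.
have cvE : cvgn E.
  by apply: nondecreasing_is_cvgn => //; exists M => _ [n _ <-]; exact: sumeps.
have [N _ HN] : \forall n \near \oo, `|limn E - E n| <= eta / 2.
  by move: (cvE) => /cvgrPdist_le; apply; rewrite divr_gt0.
have tail n m : (N <= n)%N -> (n <= m)%N -> \sum_(n <= i < m) eps i <= eta / 2.
  move=> Nn nm.
  have -> : \sum_(n <= i < m) eps i = E m - E n.
    rewrite /E -!(big_mkord xpredT eps) (@big_cat_nat _ _ _ n 0 m) //=.
    by rewrite addrAC subrr add0r.
  have := HN n Nn; rewrite ger0_norm ?subr_ge0; last exact: nondecreasing_cvgn_le.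
  by have := nondecreasing_cvgn_le ndE cvE m; lra.
have [n Nn Dn] : exists2 n, (N <= n)%N & D n <= eta / 2.
  apply: contrapT => no.
  have big n : (N <= n)%N -> eta / 2 <= D n.
    by move=> Nn; rewrite leNgt; apply/negP => lt; apply: no; exists n => //; exact: ltW.
  have [m Hm] := suma (\sum_(i < N) a i + (D 0 + M) / c / (eta / 2)).
  have Nm : (N <= m)%N.
    rewrite leqNgt; apply/negP => mN; move: Hm; apply/negP; rewrite -leNgt.
    rewrite -!(big_mkord xpredT a) (@big_cat_nat _ _ _ m 0 N) //=; last exact: ltnW.
    rewrite -addrA lerDl addr_ge0 ?sumr_ge0 // !divr_ge0 ?(ltW c0) ?(ltW eta0) //.
    by apply: le_trans (DB 0).
  move: Hm; apply/negP; rewrite -leNgt.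
  rewrite -!(big_mkord xpredT a) (@big_cat_nat _ _ _ N 0 m) //= lerD2l.
  rewrite ler_pdivlMr ?divr_gt0 // mulr_suml.
  apply: le_trans (sumaD m).
  rewrite -(big_mkord xpredT (fun i => a i * D i)) (@big_cat_nat _ _ _ N 0 m) //=.
  apply: le_trans (_ : \sum_(N <= i < m) a i * D i <= _).
    by rewrite !big_nat; apply: ler_sum => i /andP[Ni _]; rewrite ler_wpM2l // big.
  by rewrite lerDr sumr_ge0 // => i _; rewrite mulr_ge0.
exists n => // m /= nm; rewrite sub0r normrN ger0_norm //.
have := tele n m nm; have := tail n m Nn nm; have := sumpsi0 n m; lra.
Qed.

(** * Product-form distributions and the mean drift *)

Section ProductForm.
Context {R : realType} {N d : nat}.
Variables (A : 'M[R]_(N, d)) (b : 'cV[R]_N).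
Implicit Types (r v : 'cV[R]_d).

Lemma partition_functionE r :
  partition_function A b r = \sum_x expR ((A *m r + b) x 0).
Proof.
by rewrite /partition_function mxE; apply: eq_bigr => x _; rewrite !mxE mul1r.
Qed.

Lemma product_formE r x :
  product_form A b r x 0 = expR ((A *m r + b) x 0) / partition_function A b r.
Proof. by rewrite /product_form mxE mulrC !mxE. Qed.

Lemma partition_function_gt0 (x0 : 'I_N) r : 0 < partition_function A b r.
Proof.
rewrite partition_functionE (bigD1 x0) //= ltr_pwDl ?expR_gt0 //.
by apply: sumr_ge0 => x _; exact: expR_ge0.
Qed.

Lemma product_form_gt0 r x : 0 < product_form A b r x 0.
Proof. by rewrite product_formE divr_gt0 ?expR_gt0 ?(partition_function_gt0 x). Qed.

Lemma product_form_sum (x0 : 'I_N) r : \sum_x product_form A b r x 0 = 1.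
Proof.
under eq_bigr do rewrite product_formE.
rewrite -mulr_suml partition_functionE divff // -partition_functionE.
by rewrite gt_eqF // (partition_function_gt0 x0).
Qed.

Lemma product_form_le1 r x : product_form A b r x 0 <= 1.
Proof.
rewrite -(product_form_sum x r) (bigD1 x) //= lerDl.
by apply: sumr_ge0 => y _; exact/ltW/product_form_gt0.
Qed.

Lemma product_form_tilt r v (x0 x : 'I_N) :
  product_form A b (r + v) x 0 =
  product_form A b r x 0 * expR ((A *m v) x 0) /
  \sum_y product_form A b r y 0 * expR ((A *m v) y 0).
Proof.
have Z0 := partition_function_gt0 x0.
have num y : expR ((A *m (r + v) + b) y 0) =
    partition_function A b r *
    (product_form A b r y 0 * expR ((A *m v) y 0)).
  rewrite product_formE mulmxDr mulrA mulrCA divff ?mulr1 ?gt_eqF //.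
  by rewrite -expRD !mxE addrAC.
rewrite product_formE num [X in _ / X]partition_functionE.
under [in LHS]eq_bigr do rewrite num.
by rewrite -mulr_sumr -mulf_div divff ?mul1r // gt_eqF.
Qed.

Lemma product_form_translate r v c (x0 : 'I_N) :
  (forall x, (A *m v) x 0 = c) -> product_form A b (r + v) = product_form A b r.
Proof.
move=> Avc; apply/colP => x; rewrite (product_form_tilt _ _ x0) Avc.
under eq_bigr do rewrite Avc.
by rewrite -mulr_suml (product_form_sum x0) mul1r mulfK // gt_eqF ?expR_gt0.
Qed.

Lemma objectiveE (x0 : 'I_N) (alpha : 'cV[R]_N) r : \sum_x alpha x 0 = 1 ->
  objective A b alpha r =
  ln (partition_function A b r) - \sum_x alpha x 0 * (A *m r + b) x 0.
Proof.
move=> alpha1; rewrite /objective mxE.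
rewrite -[ln _]mul1r -alpha1 mulr_suml -sumrB -sumrN.
apply: eq_bigr => x _; rewrite !(mxE, product_formE).
rewrite mulrC ln_div ?posrE ?(partition_function_gt0 x0) ?expR_gt0 //.
by rewrite expRK ?mxE; ring.
Qed.

(** The objective is [ln Z(r) - <alpha, A r + b>]; its derivative at [r] in a
direction [v] is [<pi(r), A v> - <alpha, A v>], and [gamma = A^T alpha]. *)
Lemma critical_mean (x0 : 'I_N) (gamma : 'cV[R]_d) (alpha : 'cV[R]_N) r :
  target_weights A gamma alpha -> critical_point (objective A b alpha) r ->
  A^T *m product_form A b r = gamma.
Proof.
move=> [_ alpha1 gammaE] [du du0].
have {}alpha1 : \sum_x alpha x 0 = 1.
  by rewrite -alpha1 mxE; apply: eq_bigr => x _; rewrite !mxE mulr1.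
suff key v : \sum_x (A *m v) x 0 * product_form A b r x 0 =
             \sum_x alpha x 0 * (A *m v) x 0.
  rewrite gammaE; apply/colP => i; have := key (delta_mx i 0).
  have Ad x : (A *m (delta_mx i 0 : 'cV[R]_d)) x 0 = A x i by rewrite -colE mxE.
  under eq_bigr do rewrite Ad; under [RHS]eq_bigr do rewrite Ad.
  move=> kE; rewrite [LHS]mxE [RHS]mxE.
  rewrite (eq_bigr (fun x => A x i * product_form A b r x 0)) ?kE.
    by apply: eq_bigr => x _; rewrite mxE mulrC.
  by move=> x _; rewrite mxE.
have Dv0 : 'D_v (objective A b alpha) r = 0 by rewrite deriveE // du0.
pose c x := (A *m r + b) x 0; pose q x := (A *m v) x 0.
pose phi (h : R) := ln ((\sum_x (fun k : R => expR (k * q x + c x))) h)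
  - (\sum_x alpha x 0 * c x + h * \sum_x alpha x 0 * q x).
have phiE h : objective A b alpha (h *: v + r) = phi h.
  rewrite (objectiveE x0) // /phi partition_functionE fct_sumE; congr (ln _ - _).
    by apply: eq_bigr => x _; rewrite /c /q mulmxDr -scalemxAr !mxE addrA.
  rewrite mulr_sumr -big_split /=; apply: eq_bigr => x _.
  by rewrite /c /q mulmxDr -scalemxAr !mxE; ring.
have phi' : is_derive (0 : R) 1 phi
    (\sum_x q x * product_form A b r x 0 - \sum_x alpha x 0 * q x).
  have dexp x : is_derive (0 : R) 1 (fun k : R => expR (k * q x + c x))
      (q x * expR (c x)).
    have dlin : is_derive (0 : R) 1 (fun k : R => k * q x + c x) (q x).
      by apply: is_derive_eq; rewrite scaler0 addr0 add0r [_%:A]mulr1.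
    rewrite mulrC -[X in expR X](add0r (c x)) -[X in expR (X + _)](mul0r (q x)).
    exact: (is_derive1_comp (is_derive_expR _) dlin).
  have dsum : is_derive (0 : R) 1
      (\sum_x (fun k : R => expR (k * q x + c x)))
      (\sum_x q x * expR (c x)) by exact: is_derive_sum.
  have Z0E : (\sum_x (fun k : R => expR (k * q x + c x))) 0 = partition_function A b r.
    rewrite fct_sumE partition_functionE; apply: eq_bigr => x _.
    by rewrite mul0r add0r.
  have dln : is_derive ((\sum_x (fun k : R => expR (k * q x + c x))) (0 : R))
      1 (@ln R) (partition_function A b r)^-1.
    by rewrite Z0E; apply: is_derive1_ln; exact: partition_function_gt0.
  have dlin : is_derive (0 : R) 1
      (fun h : R => \sum_x alpha x 0 * c x + h * \sum_x alpha x 0 * q x)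
      (\sum_x alpha x 0 * q x).
    by apply: is_derive_eq; rewrite scaler0 !add0r mul1r [_%:A]mulr1.
  rewrite [phi](_ : _ = (@ln R \o \sum_x (fun k : R => expR (k * q x + c x))) -
    (fun h : R => \sum_x alpha x 0 * c x + h * \sum_x alpha x 0 * q x)) //.
  apply: (is_derive_eq (is_deriveB (is_derive1_comp dln dsum) dlin)).
  congr (_ - _).
  rewrite mulr_sumr; apply: eq_bigr => x _; rewrite product_formE /c /q; ring.
have : 'D_1 phi 0 = 'D_v (objective A b alpha) r.
  rewrite /derive; set F := (fun _ : R => _); set F' := (fun _ : R => _).
  suff -> : F = F' by []; apply/funext => h; rewrite /F /F' /=.
  by rewrite addr0 [h%:A]mulr1 -!phiE scale0r add0r.
by rewrite Dv0 derive_val => /eqP; rewrite subr_eq0 => /eqP.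
Qed.

(** Adding a constant to [A r] cancels in the normalisation, so the objective is
invariant under the translation by [v].  This is what turns the uniqueness of
the critical point into injectivity of [A] modulo constants. *)
Lemma critical_point_translate (x0 : 'I_N) (alpha : 'cV[R]_N) r v c :
  (forall x, (A *m v) x 0 = c) ->
  critical_point (objective A b alpha) r ->
  critical_point (objective A b alpha) (r + v).
Proof.
move=> Avc [du du0].
have Avc' x : (A *m - v) x 0 = - c by rewrite mulmxN mxE Avc.
have uE : objective A b alpha = objective A b alpha \o shift (- v).
  by apply/funext => s /=; rewrite /objective (product_form_translate s x0 Avc').
have ds : is_diff (r + v) (shift (- v)) id.
  by rewrite /shift; apply: is_diff_eq; rewrite oppr0 addr0.
have rv : shift (- v) (r + v) = r by rewrite /= addrK.
have dc : differentiable (shift (- v)) (r + v) by case: ds.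
have du' : differentiable (objective A b alpha) (shift (- v) (r + v)).
  by rewrite rv.
split; first by rewrite uE; exact: differentiable_comp dc du'.
by move=> z; rewrite uE (diff_comp dc du') rv /comp du0.
Qed.

(** Symmetrising in [x] and [y], the right-hand side is half the sum of
[w x w y (v x - v y) (exp (v x) - exp (v y))], divided by the normalisation
[Z <= exp V]; and [(v x - v y) (exp (v x) - exp (v y))] is at least
[exp (- V) (v x - v y)^2]. *)
Lemma tilt_gap (w v : 'I_N -> R) (w0 V : R) :
  0 < w0 -> (forall x, w0 <= w x) -> \sum_x w x = 1 -> (forall x, `|v x| <= V) ->
  w0 ^+ 2 * expR (- V) ^+ 2 / 2 * \sum_x \sum_y (v x - v y) ^+ 2 <=
  \sum_x v x * (w x * expR (v x) / (\sum_y w y * expR (v y)) - w x).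
Proof.
move=> w00 w0w w1 vV.
have w_gt0 x : 0 < w x by exact: lt_le_trans (w0w x).
pose Z := \sum_y w y * expR (v y).
have ZV : Z <= expR V.
  rewrite -[leRHS]mul1r -w1 mulr_suml; apply: ler_sum => x _.
  by rewrite ler_pM2l // ler_expR; have /ler_normlP[] := vV x.
have Vx x : expR (- V) <= expR (v x).
  by rewrite ler_expR lerNl; have /ler_normlP[] := vV x.
have Z0 : 0 < Z.
  apply: lt_le_trans (_ : expR (- V) <= _); first exact: expR_gt0.
  rewrite -[leLHS]mul1r -w1 mulr_suml; apply: ler_sum => x _.
  by rewrite ler_pM2l.
have gap x y : expR (- V) * (v x - v y) ^+ 2 <=
    (v x - v y) * (expR (v x) - expR (v y)).
  wlog lexy : x y / v y <= v x.
    move=> H; have [/H //|/ltW/H] := leP (v y) (v x).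
    by rewrite -sqrrN opprB -[leRHS]mulrNN !opprB.
  have := expR_ge1Dx (v x - v y); rewrite expRD expRN => e1.
  have : expR (v y) * (v x - v y) <= expR (v x) - expR (v y).
    rewrite -(ler_pM2l (expR_gt0 (v y))) in e1; move: e1.
    by rewrite mulrCA divff ?gt_eqF ?expR_gt0 // mulr1; lra.
  move=> e2; rewrite expr2 mulrCA ler_wpM2l ?subr_ge0 //.
  by apply: le_trans e2; rewrite ler_wpM2r ?subr_ge0.
have -> : \sum_x v x * (w x * expR (v x) / Z - w x) =
    (\sum_x \sum_y w x * w y * ((v x - v y) * (expR (v x) - expR (v y)))) / 2 / Z.
  have E1 : \sum_x \sum_y w x * w y * (v x * (expR (v x) - expR (v y))) =
      Z * \sum_x v x * (w x * expR (v x) / Z - w x).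
    rewrite mulr_sumr; apply: eq_bigr => x _.
    rewrite (eq_bigr (fun y => w x * v x * expR (v x) * w y -
      w x * v x * (w y * expR (v y)))); last by move=> y _; ring.
    by rewrite sumrB -!mulr_sumr w1 -/Z; field; rewrite gt_eqF.
  have E2 : \sum_x \sum_y w x * w y * (v y * (expR (v y) - expR (v x))) =
      Z * \sum_x v x * (w x * expR (v x) / Z - w x).
    rewrite exchange_big /= -E1; apply: eq_bigr => x _; apply: eq_bigr => y _; ring.
  have -> : \sum_x \sum_y w x * w y * ((v x - v y) * (expR (v x) - expR (v y))) =
      \sum_x \sum_y w x * w y * (v x * (expR (v x) - expR (v y))) +
      \sum_x \sum_y w x * w y * (v y * (expR (v y) - expR (v x))).
    rewrite -big_split; apply: eq_bigr => x _ /=.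
    by rewrite -big_split; apply: eq_bigr => y _ /=; ring.
  by rewrite E1 E2; field; rewrite gt_eqF.
rewrite ler_pdivlMr // ler_pdivlMr //.
apply: le_trans (_ : w0 ^+ 2 * expR (- V) * \sum_x \sum_y (v x - v y) ^+ 2 <= _).
  rewrite [leLHS](_ : _ = w0 ^+ 2 * expR (- V) *
    (\sum_x \sum_y (v x - v y) ^+ 2) * (Z * expR (- V))); last by field.
  rewrite ler_piMr //; last by rewrite expRN ler_pdivrMr ?expR_gt0 // mul1r.
  rewrite !mulr_ge0 ?expR_ge0 ?(ltW w00) //.
  by apply: sumr_ge0 => x _; apply: sumr_ge0 => y _; exact: sqr_ge0.
rewrite mulr_sumr; apply: ler_sum => x _; rewrite mulr_sumr; apply: ler_sum => y _.
rewrite -mulrA; apply: ler_pM => //.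
- by rewrite sqr_ge0.
- by rewrite mulr_ge0 ?expR_ge0 ?sqr_ge0.
- by rewrite expr2 ler_pM ?(ltW w00).
Qed.

(** Subtracting the row [x0] of [A] from all its rows leaves an injective matrix,
which has a left inverse; its entries provide the constant. *)
Lemma sqr_norm_le_spread (x0 : 'I_N) :
  (forall v c, (forall x, (A *m v) x 0 = c) -> v = 0) ->
  exists2 c : R, 0 < c & forall v,
    c * \sum_i v i 0 ^+ 2 <=
    \sum_x \sum_y ((A *m v) x 0 - (A *m v) y 0) ^+ 2.
Proof.
move=> inj.
pose C : 'M[R]_(N, d) := \matrix_(x, i) (A x i - A x0 i).
have CE v x : (C *m v) x 0 = (A *m v) x 0 - (A *m v) x0 0.
  by rewrite !mxE -sumrB; apply: eq_bigr => i _; rewrite mxE mulrBl.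
have : row_free C^T.
  rewrite -kermx_eq0; apply/eqP/row_matrixP => i; rewrite row0.
  apply: (can_inj (@trmxK R 1 d)); rewrite trmx0.
  apply: (inj _ ((A *m (row i (kermx C^T))^T) x0 0)) => x.
  apply/eqP; rewrite -subr_eq0 -CE.
  by rewrite -{1}[C]trmxK -trmx_mul -row_mul mulmx_ker row0 trmx0 mxE.
move=> /row_freeP[B CB].
have BC v : v = B^T *m (C *m v).
  by rewrite mulmxA -{1}[C]trmxK -trmx_mul CB trmx1 mul1mx.
pose K := \sum_i (\sum_x `|B x i|) ^+ 2.
exists (1 + K)^-1; first by rewrite invr_gt0 ltr_pwDl // sumr_ge0 // => i _; rewrite sqr_ge0.
move=> v.
set S := \sum_x \sum_y _.
have S0 : 0 <= S by apply: sumr_ge0 => x _; apply: sumr_ge0 => y _; exact: sqr_ge0.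
have CS x : `|(C *m v) x 0| <= Num.sqrt S.
  rewrite -sqrtr_sqr ler_wsqrtr // CE /S (bigD1 x) //= (bigD1 x0) //= -addrA lerDl.
  by rewrite addr_ge0 // ?sumr_ge0 // => y _; rewrite ?sqr_ge0 // sumr_ge0 // => z _; rewrite sqr_ge0.
rewrite mulrC ler_pdivrMr; last first.
  by rewrite ltr_pwDl // sumr_ge0 // => i _; rewrite sqr_ge0.
apply: le_trans (_ : S * K <= _); last by rewrite ler_wpM2l // lerDr.
rewrite /K mulr_sumr; apply: ler_sum => i _.
rewrite (_ : S * _ = (Num.sqrt S * \sum_x `|B x i|) ^+ 2); last first.
  by rewrite exprMn sqr_sqrtr.
rewrite -[leLHS]real_normK ?num_real // ler_sqr ?nnegrE ?mulr_ge0 ?sqrtr_ge0 ?sumr_ge0 //.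
rewrite {1}[v]BC mxE; apply: le_trans (ler_norm_sum _ _ _) _.
rewrite mulr_sumr; apply: ler_sum => x _.
by rewrite normrM mxE mulrC ler_wpM2r.
Qed.

Lemma mean_drift_coercive (x0 : 'I_N) (gamma : 'cV[R]_d) (alpha : 'cV[R]_N) ropt :
  target_weights A gamma alpha -> critical_point (objective A b alpha) ropt ->
  (forall r, critical_point (objective A b alpha) r -> r = ropt) ->
  (forall r, 0 <= \sum_i (r - ropt) i 0 * (A^T *m product_form A b r - gamma) i 0) /\
  forall B : R, exists2 c : R, 0 < c & forall r,
    \sum_i (r - ropt) i 0 ^+ 2 <= B ->
    c * \sum_i (r - ropt) i 0 ^+ 2 <=
    \sum_i (r - ropt) i 0 * (A^T *m product_form A b r - gamma) i 0.
Proof.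
move=> halpha hopt uniq.
have gammaE := critical_mean x0 halpha hopt.
have inj v c : (forall x, (A *m v) x 0 = c) -> v = 0.
  move=> Avc; have /uniq := critical_point_translate x0 Avc hopt.
  by move=> /eqP; rewrite -subr_eq0 addrC addKr => /eqP.
have [k k0 kP] := sqr_norm_le_spread x0 inj.
pose pi := product_form A b.
have driftE r : \sum_i (r - ropt) i 0 * (A^T *m pi r - gamma) i 0 =
    \sum_x (A *m (r - ropt)) x 0 * (pi ropt x 0 * expR ((A *m (r - ropt)) x 0) /
      (\sum_y pi ropt y 0 * expR ((A *m (r - ropt)) y 0)) - pi ropt x 0).
  transitivity (\sum_x (A *m (r - ropt)) x 0 * (pi r x 0 - pi ropt x 0)).
    rewrite -gammaE -mulmxBr.
    rewrite (eq_bigr (fun i => \sum_x A x i * (r - ropt) i 0 *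
      (pi r x 0 - pi ropt x 0))); last first.
      move=> i _; rewrite [(A^T *m _) i 0]mxE mulr_sumr; apply: eq_bigr => x _.
      by rewrite [A^T i x]mxE [(_ - product_form A b ropt) x 0]mxE
        [(- product_form A b ropt) x 0]mxE; ring.
    rewrite exchange_big /=; apply: eq_bigr => x _.
    by rewrite [(A *m _) x 0]mxE mulr_suml.
  apply: eq_bigr => x _; congr (_ * (_ - _)).
  by rewrite -(product_form_tilt _ _ x0) addrC subrK.
have [w0 w00 w0P] : exists2 w0 : R, 0 < w0 & forall x, w0 <= pi ropt x 0.
  exists (\big[Num.min/1]_x pi ropt x 0).
    by apply: lt_bigmin => // x _; exact: product_form_gt0.
  by move=> x; exact: bigmin_le_cond.
have sumw : \sum_x pi ropt x 0 = 1 by exact: product_form_sum.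
have lower r V : (forall x, `|(A *m (r - ropt)) x 0| <= V) ->
    w0 ^+ 2 * expR (- V) ^+ 2 / 2 * (k * \sum_i (r - ropt) i 0 ^+ 2) <=
    \sum_i (r - ropt) i 0 * (A^T *m pi r - gamma) i 0.
  move=> HV; rewrite driftE; apply: le_trans (tilt_gap w00 w0P sumw HV).
  by apply: ler_wpM2l; [rewrite divr_ge0 ?mulr_ge0 ?exprn_ge0 ?expR_ge0 ?(ltW w00) | exact: kP].
split=> [r|B].
  apply: le_trans (lower r (\sum_x `|(A *m (r - ropt)) x 0|) _).
    rewrite !mulr_ge0 ?sqr_ge0 ?(ltW k0) ?expR_ge0 ?(ltW w00) //.
    by apply: sumr_ge0 => i _; exact: sqr_ge0.
  by move=> x; rewrite (bigD1 x) //= lerDl sumr_ge0.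
pose V := \sum_x \sum_i `|A x i| * (1 + B).
exists (w0 ^+ 2 * expR (- V) ^+ 2 / 2 * k).
  by rewrite !mulr_gt0 ?exprn_gt0 ?expR_gt0.
move=> r rB; rewrite -mulrA; apply: lower => x.
have B0 : 0 <= B.
  by apply: le_trans rB; apply: sumr_ge0 => i _; exact: sqr_ge0.
rewrite /V (bigD1 x) //= ler_wpDr //.
  by apply: sumr_ge0 => y _; apply: sumr_ge0 => i _; rewrite mulr_ge0 // addr_ge0.
rewrite mxE; apply: le_trans (ler_norm_sum _ _ _) _; apply: ler_sum => i _.
rewrite normrM ler_wpM2l //.
have : (r - ropt) i 0 ^+ 2 <= B.
  apply: le_trans rB; rewrite (bigD1 i) //= lerDl.
  by apply: sumr_ge0 => j _; exact: sqr_ge0.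
set z := (r - ropt) i 0; rewrite -real_normK ?num_real // => zB.
have := sqr_ge0 (`|z| - 1); have := normr_ge0 z; nra.
Qed.

End ProductForm.

(** * The Poisson equation of a generator *)

Section Poisson.
Context {R : realType} {N : nat}.
Implicit Types (Q : 'M[R]_N) (p g phi : 'cV[R]_N).

(** Expanding the square, the terms in [g x ^ 2] vanish because the rows of [Q]
sum to zero and those in [g y ^ 2] because [p] is stationary. *)
Lemma dirichlet_form Q p g : generator Q -> steady_state Q p ->
  \sum_x \sum_y p x 0 * Q x y * (g x 0 - g y 0) ^+ 2 =
  - 2 * \sum_x p x 0 * g x 0 * (Q *m g) x 0.
Proof.
move=> [_ Q0] [_ pQ].
have pQ0 y : \sum_x p x 0 * Q x y = 0.
  have := congr1 (fun M : 'rV_N => M 0 y) pQ; rewrite !mxE => E; rewrite -[RHS]E.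
  by apply: eq_bigr => x _; rewrite mxE.
have E1 : \sum_x \sum_y p x 0 * Q x y * g x 0 ^+ 2 = 0.
  apply: big1 => x _; rewrite -mulr_suml -mulr_sumr Q0; ring.
have E2 : \sum_x \sum_y p x 0 * Q x y * g y 0 ^+ 2 = 0.
  by rewrite exchange_big big1 //= => y _; rewrite -mulr_suml pQ0 mul0r.
have E3 : \sum_x \sum_y p x 0 * Q x y * (g x 0 * g y 0) =
    \sum_x p x 0 * g x 0 * (Q *m g) x 0.
  apply: eq_bigr => x _; rewrite mxE mulr_sumr; apply: eq_bigr => y _; ring.
transitivity (\sum_x \sum_y p x 0 * Q x y * g x 0 ^+ 2 +
  \sum_x \sum_y p x 0 * Q x y * g y 0 ^+ 2 -
  2 * \sum_x \sum_y p x 0 * Q x y * (g x 0 * g y 0)); last first.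
  by rewrite E1 E2 E3; ring.
rewrite mulr_sumr -big_split -sumrB; apply: eq_bigr => x _ /=.
rewrite mulr_sumr -big_split -sumrB; apply: eq_bigr => y _ /=; ring.
Qed.

(** A shortest path visits each of the [N] states at most once. *)
Lemma path_oscillation (e : rel 'I_N) (g : 'I_N -> R) (D : R) :
  0 <= D -> (forall x y, e x y -> `|g x - g y| <= D) ->
  forall x y, connect e x y -> `|g x - g y| <= N%:R * D.
Proof.
move=> D0 eD x y /connectP[s es ->].
case: (shortenP es) => s' es' us' _.
apply: le_trans (_ : (size s')%:R * D <= _); last first.
  rewrite ler_wpM2r // ler_nat; move: us' => /card_uniqP /= us.
  by have := max_card (mem (x :: s')); rewrite us card_ord; exact: ltnW.
elim: s' x es' {us' es} => [x _|z s' IH x /= /andP[xz /IH zs]].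
  by rewrite /= subrr normr0 mul0r.
rewrite -[g x](subrK (g z)) -addrA mulrSr mulrDl mul1r addrC.
by apply: le_trans (ler_normD _ _) _; rewrite lerD // eD.
Qed.

Lemma total_mass p : \sum_x p x 0 = 1 -> p^T *m (const_mx 1 : 'cV[R]_N) = 1%:M.
Proof.
move=> p1; apply/matrixP => i j; rewrite !ord1 mxE.
rewrite (eq_bigr (fun x => p x 0)) ?p1 ?mxE // => x _.
by rewrite !mxE mulr1.
Qed.

Lemma mean_le p (f : 'I_N -> R) c : probability_vector p ->
  (forall x, f x <= c) -> \sum_x p x 0 * f x <= c.
Proof.
move=> [p0 p1] fc; rewrite -[leRHS]mul1r -p1 mulr_suml.
by apply: ler_sum => x _; apply: ler_wpM2l.
Qed.

Variables (Q : 'M[R]_N) (p : 'cV[R]_N) (m : R).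
Hypotheses (genQ : generator Q) (irrQ : irreducible Q) (stQ : steady_state Q p).
Hypotheses (m_gt0 : 0 < m)
  (mQ : forall x y, x != y -> 0 < Q x y -> m <= p x 0 * Q x y).

(** Every edge contributes at least [m] times a squared increment of [g] to the
Dirichlet form, and by irreducibility any two states are joined by edges. *)
Lemma oscillation_le_energy g x y :
  `|g x 0 - g y 0| <=
  N%:R * Num.sqrt ((- 2 * \sum_x p x 0 * g x 0 * (Q *m g) x 0) / m).
Proof.
rewrite -(dirichlet_form g genQ stQ).
have [Qge0 _] := genQ; have [[p0 _] _] := stQ.
have term0 i j : 0 <= p i 0 * Q i j * (g i 0 - g j 0) ^+ 2.
  have [->|ij] := eqVneq i j; first by rewrite subrr expr0n mulr0.
  by apply: mulr_ge0 (sqr_ge0 _); apply: mulr_ge0; [exact: p0 | exact: Qge0].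
apply: (path_oscillation (g := fun x => g x 0)) (irrQ x y).
  exact: sqrtr_ge0.
move=> i j /andP[ij Qij]; rewrite -sqrtr_sqr ler_wsqrtr // ler_pdivlMr //.
rewrite (bigD1 i) //= (bigD1 j) //= -addrA ler_wpDr //.
  by rewrite addr_ge0 // sumr_ge0 // => z _; rewrite ?sumr_ge0.
by rewrite mulrC ler_wpM2r ?sqr_ge0 ?mQ.
Qed.

(** The generator is singular, but subtracting the rank-one matrix [1 p^T] makes
it invertible.  On vectors of [p]-mean zero the inverse solves the Poisson
equation and coincides, up to sign, with the deviation matrix of the chain.  An
explicit inverse makes the solution a measurable function of the rates. *)
Definition deviation_mx : 'M[R]_N := invmx (Q - const_mx 1 *m p^T).

Lemma bordered_generator_unit : Q - (const_mx 1 : 'cV[R]_N) *m p^T \in unitmx.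
Proof.
have [[p0 p1] pQ] := stQ.
set M := Q - _.
have inj g : M *m g = 0 -> g = 0.
  move=> Mg.
  have p1E := total_mass p1.
  have pM : p^T *m M = - p^T by rewrite mulmxBr pQ mulmxA p1E mul1mx sub0r.
  have pg : p^T *m g = 0.
    by apply: oppr_inj; rewrite -mulNmx -pM -mulmxA Mg mulmx0 oppr0.
  have Qg : Q *m g = 0.
    by move: Mg; rewrite mulmxBl -mulmxA pg mulmx0 subr0.
  have cst x y : g x 0 = g y 0.
    apply/eqP; rewrite -subr_eq0 -normr_le0.
    apply: le_trans (oscillation_le_energy g x y) _.
    by rewrite Qg big1 ?mulr0 ?mul0r ?sqrtr0 ?mulr0 // => i _; rewrite mxE mulr0.
  apply/colP => x; rewrite mxE.
  have := congr1 (fun B : 'M[R]_1 => B ord0 ord0) pg; rewrite mxE [RHS]mxE => E; rewrite -[RHS]E.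
  rewrite -[LHS]mul1r -p1 mulr_suml; apply: eq_bigr => y _.
  by rewrite mxE (cst x y).
rewrite -unitmx_tr -row_free_unit -kermx_eq0; apply/eqP/row_matrixP => i.
rewrite row0; apply: (can_inj (@trmxK R 1 N)); rewrite trmx0; apply: inj.
by rewrite -{1}[M]trmxK -trmx_mul -row_mul mulmx_ker row0 trmx0.
Qed.

Lemma poisson_equation phi : p^T *m phi = 0 ->
  Q *m (- (deviation_mx *m phi)) = - phi /\ p^T *m (deviation_mx *m phi) = 0.
Proof.
move=> pphi; set g := deviation_mx *m phi.
have [[p0 p1] pQ] := stQ.
have Mg : (Q - const_mx 1 *m p^T) *m g = phi.
  by rewrite /g /deviation_mx mulmxA mulmxV ?mul1mx // bordered_generator_unit.
have p1E := total_mass p1.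
have pM : p^T *m (Q - const_mx 1 *m p^T) = - p^T.
  by rewrite mulmxBr pQ mulmxA p1E mul1mx sub0r.
have pg : p^T *m g = 0.
  by apply: oppr_inj; rewrite -mulNmx -pM -mulmxA Mg pphi oppr0.
split=> //; rewrite mulmxN; congr (- _).
by move: Mg; rewrite mulmxBl -mulmxA pg mulmx0 subr0.
Qed.

(** With [K = max |g|], the energy of [g] is [- 2 <g, phi>_p <= 2 K], so the
oscillation of [g] is at most [N sqrt (2 K / m)].  Since [g] has mean zero, its
oscillation dominates [K]; solving [K <= N sqrt (2 K / m)] for [K] gives the
bound. *)
Lemma deviation_le phi x : p^T *m phi = 0 -> (forall y, `|phi y 0| <= 1) ->
  `|(deviation_mx *m phi) x 0| <= 2 * N%:R ^+ 2 / m.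
Proof.
move=> pphi phi1; have [Qg pg] := poisson_equation pphi.
have [[p0 p1] _] := stQ.
set g := deviation_mx *m phi in Qg pg *.
have {}Qg : Q *m g = phi by move: Qg; rewrite mulmxN => /oppr_inj.
pose K : R := \big[Num.max/0]_y `|g y 0|.
have gK y : `|g y 0| <= K by apply: le_bigmax.
have K0 : 0 <= K by apply: bigmax_ge_id.
pose E : R := - 2 * \sum_x p x 0 * g x 0 * (Q *m g) x 0.
have E_le : E <= 2 * K.
  rewrite /E mulNr -mulrN ler_pM2l // -sumrN.
  rewrite (eq_bigr (fun y => p y 0 * - (g y 0 * phi y 0))); last first.
    by move=> y _; rewrite Qg; ring.
  apply: mean_le => [|y]; first by case: stQ.
  apply: le_trans (ler_norm _) _; rewrite normrN normrM -[leRHS]mulr1.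
  by rewrite ler_pM.
have osc i j : `|g i 0 - g j 0| <= N%:R * Num.sqrt (2 * K / m).
  apply: le_trans (oscillation_le_energy g i j) _; rewrite ler_wpM2l // ler_wsqrtr //.
  by rewrite ler_wpM2r // invr_ge0 ltW.
have gb i : `|g i 0| <= N%:R * Num.sqrt (2 * K / m).
  have -> : g i 0 = \sum_j p j 0 * (g i 0 - g j 0).
    rewrite (eq_bigr (fun j => p j 0 * g i 0 - p j 0 * g j 0)); last first.
      by move=> j _; rewrite mulrBr.
    rewrite sumrB -mulr_suml p1 mul1r.
    have := congr1 (fun B : 'M[R]_1 => B ord0 ord0) pg; rewrite mxE [RHS]mxE => pg0.
    rewrite (eq_bigr (fun j => p^T 0 j * g j 0)) ?pg0 ?subr0 //.
    by move=> j _; rewrite [p^T _ _]mxE.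
  apply: le_trans (ler_norm_sum _ _ _) _.
  rewrite (eq_bigr (fun j => p j 0 * `|g i 0 - g j 0|)).
    by apply: mean_le => //; case: stQ.
  by move=> j _; rewrite normrM ger0_norm.
have KE : K <= N%:R * Num.sqrt (2 * K / m).
  by apply/bigmax_leP; split=> //; rewrite mulr_ge0 ?sqrtr_ge0.
apply: le_trans (gK x) _; rewrite ler_pdivlMr //.
have [->|Kn0] := eqVneq K 0; first by rewrite mul0r mulr_ge0 ?exprn_ge0.
have Kp : 0 < K by rewrite lt_def Kn0.
have : K ^+ 2 <= (N%:R * Num.sqrt (2 * K / m)) ^+ 2.
  by rewrite ler_sqr ?nnegrE ?mulr_ge0 ?sqrtr_ge0.
rewrite exprMn sqr_sqrtr ?divr_ge0 ?mulr_ge0 ?(ltW m_gt0) // => K2.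
rewrite -(ler_pM2l Kp).
have {}K2 : K ^+ 2 * m <= N%:R ^+ 2 * (2 * K / m) * m by rewrite ler_pM2r.
apply: le_trans (_ : K ^+ 2 * m <= _); first by rewrite expr2 mulrA.
by apply: le_trans K2 _; rewrite le_eqVlt; apply/orP; left; apply/eqP; field; rewrite gt_eqF.
Qed.

End Poisson.

Definition norm1 {R : realType} {d : nat} (r : 'cV[R]_d) : R := \sum_i `|r i 0|.

Section Rates.
Context {R : realType} {N d : nat}.
Variables (A : 'M[R]_(N, d)) (b : 'cV[R]_N) (Q : 'cV[R]_d -> 'M[R]_N).
Hypothesis hQ : product_form_network A b Q.

Lemma coord_le_norm1 (r : 'cV[R]_d) i : `|r i 0| <= norm1 r.
Proof. by rewrite /norm1 (bigD1 i) //= lerDl sumr_ge0. Qed.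

Lemma norm1_ge0 (r : 'cV[R]_d) : 0 <= norm1 r.
Proof. exact: sumr_ge0. Qed.

Lemma rate_cases x y : x != y ->
  (exists i, forall r, Q r x y = expR (r i 0)) \/ (forall r, Q r x y = Q 0 x y).
Proof.
move=> xy; have [[i [_ ci]]|no] := pselect (exists i, configured_by Q i x y).
  by left; exists i => r; have [Q0 ->] := ci r; rewrite lnK.
right=> r; apply: (pfn_fixed hQ) => // i ci; apply: no; by exists i.
Qed.

(** A configurable rate is [exp (r i)], which is [1] at [r = 0]; the other rates
do not depend on [r].  Comparing with [Q 0] treats both kinds alike. *)
Lemma rate_bounds r x y : x != y ->
  Q 0 x y * expR (- norm1 r) <= Q r x y <= Q 0 x y * expR (norm1 r).
Proof.
move=> xy; have [[i Qi]|Qf] := rate_cases xy.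
  rewrite !Qi mxE expR0 !mul1r !ler_expR.
  by have := coord_le_norm1 r i; rewrite ler_norml.
rewrite Qf; have Q0 := (pfn_generator hQ 0).1 _ _ xy.
apply/andP; split.
  by rewrite ler_piMr // -expR0 ler_expR oppr_le0 norm1_ge0.
by rewrite ler_peMr // -expR0 ler_expR norm1_ge0.
Qed.

Lemma rate_support r x y : x != y -> (0 < Q r x y) = (0 < Q 0 x y).
Proof.
move=> xy; have [[i Qi]|Qf] := rate_cases xy; last by rewrite Qf.
by rewrite !Qi !expR_gt0.
Qed.

Lemma generator_entry_bounded (B : R) :
  exists q : R, forall r, norm1 r <= B -> forall x y, `|Q r x y| <= q.
Proof.
pose q : R := \sum_x \sum_(y | y != x) Q 0 x y * expR B.
have Q0 x y : y != x -> 0 <= Q 0 x y.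
  by move=> yx; apply: (pfn_generator hQ 0).1; rewrite eq_sym.
have off0 x : 0 <= \sum_(y | y != x) Q 0 x y * expR B.
  by apply: sumr_ge0 => y yx; rewrite mulr_ge0 ?expR_ge0 ?Q0.
exists q => r rB.
have offle x y : y != x -> 0 <= Q r x y <= Q 0 x y * expR B.
  move=> yx; rewrite (pfn_generator hQ r).1 1?eq_sym //=.
  have xy : x != y by rewrite eq_sym.
  have /andP[_ le] := rate_bounds r xy; apply: le_trans le _.
  by rewrite ler_wpM2l ?Q0 // ler_expR.
have rowle x : \sum_(y | y != x) Q 0 x y * expR B <= q.
  by rewrite /q [leRHS](bigD1 x) //= lerDl sumr_ge0.
move=> x y; have [->|yx] := eqVneq y x.
  have /eqP := (pfn_generator hQ r).2 x; rewrite (bigD1 x) //= addr_eq0 => /eqP ->.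
  rewrite normrN; apply: le_trans (rowle x); apply: le_trans (ler_norm_sum _ _ _) _.
  by apply: ler_sum => z /offle/andP[z0 zle]; rewrite ger0_norm.
apply: le_trans (rowle x); have /andP[z0 zle] := offle _ _ yx.
rewrite ger0_norm // (bigD1 y) //= ler_wpDr //.
by apply: sumr_ge0 => z /andP[zx _]; rewrite mulr_ge0 ?expR_ge0 ?Q0.
Qed.

Lemma product_form_lower : exists2 c : R, 0 <= c & forall r x,
  expR (- c * (1 + norm1 r)) / N%:R <= product_form A b r x 0.
Proof.
pose M : R := \sum_x (\sum_i `|A x i| + `|b x 0|).
have M0 : 0 <= M by apply: sumr_ge0 => x _; rewrite addr_ge0 // sumr_ge0.
have le r x : `|(A *m r + b) x 0| <= M * (1 + norm1 r).
  apply: le_trans (_ : (\sum_i `|A x i| + `|b x 0|) * (1 + norm1 r) <= _).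
    rewrite 2!mxE; apply: le_trans (ler_normD _ _) _.
    rewrite [leRHS]mulrDl lerD //; last by rewrite ler_peMr // lerDl norm1_ge0.
    apply: le_trans (ler_norm_sum _ _ _) _; rewrite mulr_suml.
    apply: ler_sum => i _; rewrite normrM ler_wpM2l //.
    by apply: le_trans (coord_le_norm1 r i) _; rewrite lerDr.
  rewrite ler_wpM2r ?addr_ge0 ?norm1_ge0 // /M [leRHS](bigD1 x) //= lerDl.
  by apply: sumr_ge0 => y _; rewrite addr_ge0 // sumr_ge0.
exists (2 * M); first by rewrite mulr_ge0.
move=> r x; rewrite product_formE.
have N0 : 0 < N%:R :> R by rewrite ltr0n (leq_ltn_trans _ (ltn_ord x)).
rewrite ler_pdivlMr ?(partition_function_gt0 A b x) // mulrAC ler_pdivrMr //.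
apply: le_trans (_ : expR (- (2 * M) * (1 + norm1 r)) *
    (N%:R * expR (M * (1 + norm1 r))) <= _).
  rewrite ler_wpM2l ?expR_ge0 // partition_functionE.
  apply: le_trans (_ : \sum_(x < N) expR (M * (1 + norm1 r)) <= _).
    by apply: ler_sum => y _; rewrite ler_expR; have := le r y; rewrite ler_norml => /andP[].
  by rewrite sumr_const card_ord mulr_natl.
rewrite mulrCA mulrC ler_wpM2r ?(ltW N0) // -expRD ler_expR.
have := le r x; rewrite ler_norml => /andP[lo _]; apply: le_trans lo.
by rewrite le_eqVlt; apply/orP; left; apply/eqP; ring.
Qed.

(** The stationary flow through an edge decays at most exponentially in the size
of the parameters, uniformly over the edges: the support of [Q r] is that
of [Q 0], so the smallest positive rate of [Q 0] controls all of them. *)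
Lemma deviation_growth : exists C c : R, [/\ 0 < C, 0 < c &
  forall r (phi : 'cV[R]_N), (product_form A b r)^T *m phi = 0 ->
    (forall y, `|phi y 0| <= 1) -> forall x,
  `|(deviation_mx (Q r) (product_form A b r) *m phi) x 0| <= C * expR (c * norm1 r)].
Proof.
have [c c0 pi_lower] := product_form_lower.
have [q0 q00 q0P] : exists2 q0 : R, 0 < q0 &
    forall x y, 0 < Q 0 x y -> q0 <= Q 0 x y.
  exists (\big[Num.min/1]_(z : 'I_N * 'I_N | 0 < Q 0 z.1 z.2) Q 0 z.1 z.2).
    by apply: lt_bigmin.
  by move=> x y Qxy; apply: (bigmin_le_cond _ (j := (x, y))).
exists (2 * N%:R ^+ 2 * N%:R / q0 * expR c + 1), (c + 1).
have C0 : 0 <= 2 * N%:R ^+ 2 * N%:R / q0 * expR c :> R.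
  by rewrite !mulr_ge0 ?exprn_ge0 ?expR_ge0 // invr_ge0 ltW.
split; [by rewrite ltr_wpDl | by rewrite ltr_wpDl |].
move=> r phi pphi phi1 x.
have N0 : 0 < N%:R :> R by rewrite ltr0n (leq_ltn_trans _ (ltn_ord x)).
pose m := expR (- c * (1 + norm1 r)) / N%:R * (q0 * expR (- norm1 r)).
have m0 : 0 < m by rewrite !mulr_gt0 ?expR_gt0 ?invr_gt0.
have mQ y z : y != z -> 0 < Q r y z -> m <= product_form A b r y 0 * Q r y z.
  move=> yz; rewrite rate_support // => Qyz.
  apply: ler_pM => //; rewrite ?divr_ge0 ?mulr_ge0 ?expR_ge0 ?(ltW q00) //.
  have /andP[le _] := rate_bounds r yz; apply: le_trans le.
  by rewrite ler_wpM2r ?expR_ge0 ?q0P.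
have := deviation_le (pfn_generator hQ r) (@pfn_irreducible _ _ _ _ _ _ hQ r)
  (pfn_steady_state hQ r) m0 mQ x pphi phi1.
move=> /le_trans; apply.
apply: le_trans (_ : (2 * N%:R ^+ 2 * N%:R / q0 * expR c) * expR ((c + 1) * norm1 r) <= _).
  have -> : expR ((c + 1) * norm1 r) = expR (c * norm1 r) * expR (norm1 r).
    by rewrite -expRD; congr expR; ring.
  have mE : m = (expR c)^-1 * (expR (c * norm1 r))^-1 / N%:R * (q0 / expR (norm1 r)).
    rewrite /m -!expRN -expRD; congr (expR _ / _ * _); ring.
  rewrite mE.
  rewrite le_eqVlt; apply/orP; left; apply/eqP; field.
  by rewrite !gt_eqF ?expR_gt0.
by rewrite ler_wpM2r ?expR_ge0 // lerDl.
Qed.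

End Rates.

(** * Matrix limits and the matrix exponential *)

Section MatrixLimits.
Context {R : realType}.

Lemma cvg_mx_entries m n {T : Type} (F : set_system T) {FF : Filter F}
    (M : T -> 'M[R]_(m, n)) (L : 'M[R]_(m, n)) :
  (forall i j, M x i j @[x --> F] --> L i j) -> M x @[x --> F] --> L.
Proof.
move=> ML S [P LP PS].
apply: filterS (_ : \forall x \near F, forall ij : 'I_m * 'I_n, P ij.1 ij.2 (M x ij.1 ij.2)).
  by move=> x Px; apply: PS => i j; have := Px (i, j).
by apply: filter_forall => -[i j] /=; exact: ML (LP i j).
Qed.

Context {N : nat}.
Implicit Types Q : 'M[R]_N.

(** The scalar series of the entry [(x, y)]: convergence, bounds and
measurability of [expmx] are read off entry by entry. *)
Definition exp_partial Q x y : R ^nat :=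
  series (fun k => (k`!%:R)^-1 * (Q ^+ k) x y).

Lemma expr_entry_le Q (q : R) k x y : (forall x y, `|Q x y| <= q) ->
  `|(Q ^+ k) x y| <= (N%:R * q) ^+ k.
Proof.
move=> Qq; have q0 : 0 <= q by apply: le_trans (Qq x y).
elim: k x y => [|k IH] x y.
  by rewrite !expr0 mxE; case: eqVneq => _; rewrite ?normr1 ?normr0.
rewrite exprSr mxE; apply: le_trans (ler_norm_sum _ _ _) _.
apply: le_trans (_ : \sum_(z < N) (N%:R * q) ^+ k * q <= _).
  by apply: ler_sum => z _; rewrite normrM ler_pM.
by rewrite sumr_const card_ord -mulr_natl exprSr; lra.
Qed.

Lemma exp_term_le Q (q : R) k x y : (forall x y, `|Q x y| <= q) ->
  `|(k`!%:R)^-1 * (Q ^+ k) x y| <= exp_coeff (N%:R * q) k.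
Proof.
move=> Qq; rewrite normrM ger0_norm ?invr_ge0 // mulrC.
by rewrite ler_wpM2r ?invr_ge0 // expr_entry_le.
Qed.

Lemma exp_partial_cvg Q x y : cvgn (exp_partial Q x y).
Proof.
pose q : R := \sum_i \sum_j `|Q i j|.
have Qq i j : `|Q i j| <= q.
  rewrite /q (bigD1 i) //= (bigD1 j) //= -addrA lerDl.
  by rewrite addr_ge0 ?sumr_ge0 // => k _; rewrite sumr_ge0.
have q0 : 0 <= q by apply: sumr_ge0 => i _; apply: sumr_ge0.
apply: (@normed_cvg _ R^o); apply: (series_le_cvg _ _ _ (is_cvg_series_exp_coeff (N%:R * q))).
- by move=> k; exact: normr_ge0.
- by move=> k; apply: exp_coeff_ge0; rewrite mulr_ge0.
- by move=> k; exact: exp_term_le.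
Qed.

Lemma expmxE Q x y : expmx Q x y = limn (exp_partial Q x y).
Proof.
rewrite /expmx; set S := series _.
suff -> : limn S = \matrix_(i, j) limn (exp_partial Q i j) by rewrite mxE.
apply: cvg_lim; first exact: norm_hausdorff.
apply: cvg_mx_entries => i j; rewrite mxE.
have -> : (fun k => S k i j) = exp_partial Q i j.
  apply/funext => k; rewrite /S /exp_partial /series /= summxE.
  by apply: eq_bigr => l _; rewrite mxE.
exact: exp_partial_cvg.
Qed.

Lemma expr_scalemx (h : R) Q k : (h *: Q) ^+ k = h ^+ k *: Q ^+ k.
Proof.
elim: k => [|k IH]; first by rewrite !expr0 scale1r.
rewrite exprSr IH -[LHS]/(_ *m _) -scalemxAl -scalemxAr scalerA -exprSr.
by rewrite [in RHS](exprSr Q).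
Qed.

(** The terms of order at least two of the series carry a factor [h ^ 2], as
[h <= 1], and what remains is dominated by the series of [exp (N q)]. *)
Lemma expmx_first_order Q (q h : R) x y : (forall x y, `|Q x y| <= q) ->
  0 <= h <= 1 ->
  `|expmx (h *: Q) x y - (x == y)%:R - h * Q x y| <= h ^+ 2 * expR (N%:R * q).
Proof.
move=> Qq /andP[h0 h1].
have q0 : 0 <= q by apply: le_trans (Qq x y).
have cv := @exp_partial_cvg (h *: Q) x y.
have cv' : `|exp_partial (h *: Q) x y n - (x == y)%:R - h * Q x y| @[n --> \oo]
    --> `|expmx (h *: Q) x y - (x == y)%:R - h * Q x y|.
  rewrite expmxE; apply: cvg_norm; apply: cvgB; last exact: cvg_cst.
  by apply: cvgB; [exact: cv | exact: cvg_cst].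
apply: (cvgr_to_le cv').
exists 2%N => // n /= n2.
have -> : exp_partial (h *: Q) x y n - (x == y)%:R - h * Q x y =
    \sum_(2 <= k < n) (k`!%:R)^-1 * ((h *: Q) ^+ k) x y.
  rewrite /exp_partial /series /= (big_cat_nat _ (n := 2)) //= !big_nat_recr //= big_geq //.
  rewrite expr0 expr1 !mxE !fact0 ?factS ?muln1 ?invr1; ring.
apply: le_trans (ler_norm_sum _ _ _) _.
apply: le_trans (_ : h ^+ 2 * series (exp_coeff (N%:R * q)) n <= _); last first.
  rewrite ler_wpM2l ?exprn_ge0 //; apply: nondecreasing_cvgn_le.
    by apply: nondecreasing_series => k _ _; apply: exp_coeff_ge0; rewrite mulr_ge0.
  exact: is_cvg_series_exp_coeff.
rewrite /series /= mulr_sumr [leRHS](big_cat_nat _ (n := 2)) //= ler_wpDl //.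
  by apply: sumr_ge0 => k _; rewrite mulr_ge0 ?exprn_ge0 ?exp_coeff_ge0 ?mulr_ge0.
rewrite !big_nat; apply: ler_sum => k /andP[k2 _].
rewrite expr_scalemx mxE mulrCA normrM ler_pM //; last exact: exp_term_le.
by rewrite ger0_norm ?exprn_ge0 // ler_wiXn2l.
Qed.

End MatrixLimits.

Section MatrixMeasurability.
Context {R : realType} {dT : measure_display} {T : measurableType dT}.
Implicit Types f : T -> R.

(** [1 / y = y (y ^ 2) ^ (-1)] holds for every real [y], including [0], and real
powers of nonnegative numbers are measurable. *)
Lemma measurable_fun_inv f : measurable_fun setT f ->
  measurable_fun setT (fun w => (f w)^-1).
Proof.
move=> mf.
have -> : (fun w => (f w)^-1) = (fun w => f w * powR (f w ^+ 2) (-1)).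
  apply/funext => w; rewrite powR_inv1 ?sqr_ge0 //.
  have [->|fw] := eqVneq (f w) 0; first by rewrite invr0 mul0r.
  by rewrite expr2 invfM mulrA divff ?mul1r.
apply: measurable_funM => //.
by apply: (measurableT_comp (measurable_powR (-1))); exact: measurable_funX.
Qed.

Definition mx_measurable m n (M : T -> 'M[R]_(m, n)) :=
  forall i j, measurable_fun setT (fun w => M w i j).

Lemma mx_measurable_mul m n p (M : T -> 'M[R]_(m, n)) (L : T -> 'M[R]_(n, p)) :
  mx_measurable M -> mx_measurable L -> mx_measurable (fun w => M w *m L w).
Proof.
move=> mM mL i j.
rewrite (_ : (fun w => _) = (fun w => \sum_k M w i k * L w k j)); last first.
  by apply/funext => w; rewrite mxE.
by apply: measurable_sum => k; apply: measurable_funM.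
Qed.

Lemma mx_measurable_det n (M : T -> 'M[R]_n) : mx_measurable M ->
  measurable_fun setT (fun w => \det (M w)).
Proof.
move=> mM; rewrite /determinant; apply: measurable_sum => s.
by apply: measurable_funM => //; apply: measurable_prod => i _; exact: mM.
Qed.

(** Cramer's rule writes the entries of the inverse as quotients of
polynomials. *)
Lemma mx_measurable_inv n (M : T -> 'M[R]_n) : (forall w, M w \in unitmx) ->
  mx_measurable M -> mx_measurable (fun w => invmx (M w)).
Proof.
move=> uM mM i j.
rewrite (_ : (fun w => _) = (fun w => (\det (M w))^-1 *
    ((-1) ^+ (j + i) * \det (row' j (col' i (M w)))))); last first.
  by apply/funext => w; rewrite /invmx uM !mxE.
apply: measurable_funM; first exact/measurable_fun_inv/mx_measurable_det.
apply: measurable_funM => //; apply: mx_measurable_det => k l.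
by under eq_fun do rewrite !mxE; exact: mM.
Qed.

Lemma mx_measurable_expmx n (M : T -> 'M[R]_n) :
  mx_measurable M -> mx_measurable (fun w => expmx (M w)).
Proof.
move=> mM i j.
apply: (@measurable_fun_cvg _ _ _ _ (fun k w => exp_partial (M w) i j k)).
  move=> k; rewrite /exp_partial /series /=.
  apply: measurable_sum => l; apply: measurable_funM => //.
  elim: l i j => [|l IH] i j.
    by under eq_fun do rewrite expr0; exact: measurable_cst.
  have := mx_measurable_mul IH mM i j.
  by under [in X in _ -> X]eq_fun do rewrite exprSr.
by move=> w _; rewrite expmxE; exact: exp_partial_cvg.
Qed.

End MatrixMeasurability.

(** * Riemann sums along right-continuous paths *)

Lemma integral_step d (T : measurableType d) (R : realType)
    (mu : {measure set T -> \bar R}) (D : set T) n (A : 'I_n -> set T)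
    (c : 'I_n -> R) :
  measurable D -> (forall j, measurable (A j)) -> (forall j, 0 <= c j) ->
  (\int[mu]_(s in D) (\sum_j c j * \1_(A j) s)%:E =
   \sum_j (c j)%:E * mu (A j `&` D))%E.
Proof.
move=> mD mA c0.
have mI j : measurable_fun D (fun s => (\1_(A j) s : R)%:E).
  by apply/measurable_EFinP; exact: measurable_indic.
transitivity (\int[mu]_(s in D) (\sum_j (c j)%:E * (\1_(A j) s)%:E))%E.
  by apply: eq_integral => s _; rewrite -sumEFin; apply: eq_bigr => j _; rewrite EFinM.
rewrite ge0_integral_sum //; last 2 first.
- by move=> j; apply: emeasurable_funM.
- by move=> j s _; rewrite mule_ge0 // lee_fin ?indicE.
apply: eq_bigr => j _.
rewrite ge0_integralZl //.
- by rewrite integral_indic.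
- by rewrite lee_fin.
Qed.

Section RiemannSums.
Context {R : realType}.
Variables (a b : R) (c : R -> R).
Hypotheses (ab : a < b) (c0 : forall s, 0 <= c s) (c1 : forall s, c s <= 1)
  (c_right : forall s, a <= s < b -> \forall v \near s^'+, c v = c s).

Definition grid_point (k : nat) (j : nat) : R := a + (b - a) / k.+1%:R * j%:R.

Lemma grid_pointS k j : grid_point k j.+1 = grid_point k j + (b - a) / k.+1%:R.
Proof. by rewrite /grid_point -[j.+1%:R]natr1 mulrDr mulr1 addrA. Qed.

Lemma grid_point_last k : grid_point k k.+1 = b.
Proof. by rewrite /grid_point mulfVK // addrC subrK. Qed.

Lemma grid_point0 k : grid_point k 0 = a.
Proof. by rewrite /grid_point mulr0 addr0. Qed.

Lemma mesh_gt0 k : 0 < (b - a) / k.+1%:R.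
Proof. by rewrite divr_gt0 // subr_gt0. Qed.

Lemma grid_point_le k i j : (i <= j)%N -> grid_point k i <= grid_point k j.
Proof.
by move=> ij; rewrite lerD2l ler_wpM2l ?ler_nat // ltW // mesh_gt0.
Qed.

(** On each cell of the grid, the value of [c] at the right end of the cell.
Right end points approach every [s] from the right, which is the side on which
the path is continuous. *)
Definition right_step (k : nat) (s : R) : R :=
  \sum_(j < k.+1) c (grid_point k j.+1) *
    \1_(`[grid_point k j, grid_point k j.+1[) s.

Lemma right_step_eval k s : a <= s < b ->
  exists2 v, s < v <= s + (b - a) / k.+1%:R & right_step k s = c v.
Proof.
move=> /andP[sa sb]; set h := (b - a) / k.+1%:R; have h0 : 0 < h := mesh_gt0 k.
pose j := Num.trunc ((s - a) / h).
have /andP[j1 j2] : j%:R <= (s - a) / h < j.+1%:R.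
  by apply: truncn_itv; rewrite divr_ge0 ?subr_ge0 // ltW.
have lo : grid_point k j <= s.
  by move: j1; rewrite ler_pdivlMr // /grid_point -/h => ?; lra.
have hi : s < grid_point k j.+1.
  by move: j2; rewrite ltr_pdivrMr // /grid_point -/h => ?; lra.
have jk : (j < k.+1)%N.
  rewrite ltnNge; apply/negP => kj; have := grid_point_le k kj.
  by rewrite grid_point_last; lra.
exists (grid_point k j.+1).
  by rewrite hi /= grid_pointS lerD2r.
rewrite /right_step (bigD1 (Ordinal jk)) //= indicE mem_set /=; last first.
  by rewrite in_itv /= lo.
rewrite mulr1 big1 ?addr0 // => i; rewrite -val_eqE /= => ij.
rewrite indicE memNset ?mulr0 //= in_itv /= => /andP[i1 i2]; move: ij.
have [ij|ij|//] := ltngtP i j.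
  by have := grid_point_le k ij; lra.
by have := grid_point_le k ij; lra.
Qed.

Lemma right_step_cvg s : a <= s < b -> right_step k s @[k --> \oo] --> c s.
Proof.
move=> sab; have /nbhs_right0P := c_right sab; move=>  [e /= e0 He].
have meshP : \forall k \near \oo, (b - a) / k.+1%:R < e.
  have : (b - a) * harmonic k @[k --> \oo] --> (b - a) * 0.
    by apply: cvgM; [exact: cvg_cst | exact: cvg_harmonic].
  by rewrite mulr0 => /cvgr_lt; apply.
apply: cvg_near_cst.
apply: filterS meshP => k ke.
have [v /andP[v1 v2] ->] := right_step_eval k sab.
have := He (v - s); rewrite /= sub0r normrN gtr0_norm ?subr_gt0 // => /(_ _ _)/=.
rewrite (addrC s) subrK; apply => //; apply: le_lt_trans ke; rewrite lerBlDl; exact: v2.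
Qed.

Lemma right_step_bound k s : a <= s < b -> 0 <= right_step k s <= 1.
Proof. by move=> /(right_step_eval k)[v _ ->]; rewrite c0 c1. Qed.

Lemma right_step_measurable k (D : set R) : measurable_fun D (right_step k).
Proof.
apply: measurable_sum => j.
by apply: measurable_funM => //; apply: measurable_indic; exact: measurable_itv.
Qed.

Lemma integral_right_step k :
  (\int[lebesgue_measure]_(s in `[a, b[) (right_step k s)%:E =
  ((b - a) / k.+1%:R * \sum_(j < k.+1) c (grid_point k j.+1))%:E)%E.
Proof.
rewrite integral_step; last 3 first.
- exact: measurable_itv.
- by move=> j; exact: measurable_itv.
- by move=> j; exact: c0.
rewrite mulr_sumr -sumEFin; apply: eq_bigr => j _.
rewrite setIidl; last first.
  move=> s /=; rewrite !in_itv /= => /andP[s1 s2]; apply/andP; split.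
    by rewrite (le_trans _ s1) // -(grid_point0 k) grid_point_le.
  by rewrite (lt_le_trans s2) // -(grid_point_last k) grid_point_le.
rewrite mulrC EFinM; congr (_ * _)%E.
apply: (etrans (lebesgue_measure_itv `[grid_point k j, grid_point k j.+1[%O)).
rewrite /= lte_fin.
by rewrite grid_pointS ltrDl mesh_gt0 -EFinB addrAC subrr add0r.
Qed.

(** Dominated convergence applies to the right-endpoint steps; the means over
left end points differ from those over right end points by
[(c a - c b) / (k + 1)]. *)
Lemma riemann_sum_cvg :
  (k.+1%:R)^-1 * \sum_(j < k.+1) c (grid_point k j) @[k --> \oo] -->
  (b - a)^-1 * \int[lebesgue_measure]_(s in `[a, b]) c s.
Proof.
have mD : measurable `[a, b[%classic by exact: measurable_itv.
have inD (s : R) : `[a, b[%classic s -> a <= s < b by rewrite /= in_itv.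
have muD : (lebesgue_measure `[a, b[%classic < +oo)%E.
  by rewrite lebesgue_measure_itv /= lte_fin ab -EFinB ltry.
have mc : measurable_fun `[a, b[ c.
  apply: (@measurable_fun_cvg _ _ _ _ right_step).
    by move=> k; exact: right_step_measurable.
  by move=> s /inD; exact: right_step_cvg.
have ic : lebesgue_measure.-integrable `[a, b[ (EFin \o c).
  apply: measurable_bounded_integrable => //.
  exists 1; split; first exact: num_real.
  by move=> M M1 s _ /=; rewrite ger0_norm // (le_trans (c1 s)) // ltW.
have cvE : (\int[lebesgue_measure]_(s in `[a, b[) (right_step k s)%:E
    @[k --> \oo] --> \int[lebesgue_measure]_(s in `[a, b[) (c s)%:E)%E.
  apply: (@dominated_cvg _ _ _ (@lebesgue_measure R) _ mD
    (fun k s => (right_step k s)%:E) (EFin \o c) (cst 1%E)).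
  - by move=> k; apply/measurable_EFinP; exact: right_step_measurable.
  - by move=> s /inD sD; apply: cvg_EFin; [exact: nearW | exact: right_step_cvg].
  - by [].
  - apply: measurable_bounded_integrable => //.
    by exists 1; split=> [|M M1 s _ /=]; rewrite ?num_real // normr1 ltW.
  - move=> k s /inD sD; have /andP[r0 r1] := right_step_bound k sD.
    by rewrite /= lee_fin ger0_norm.
have cvR : ((b - a) / k.+1%:R * \sum_(j < k.+1) c (grid_point k j.+1))
    @[k --> \oo] --> \int[lebesgue_measure]_(s in `[a, b[) c s.
  apply: (@fine_cvg _ _ _ _ (fun k => ((b - a) / k.+1%:R *
    \sum_(j < k.+1) c (grid_point k j.+1))%:E)).
  rewrite /Rintegral fineK; last exact: integrable_fin_num.
  by under eq_fun do rewrite -integral_right_step.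
have -> : (fun k => (k.+1%:R)^-1 * \sum_(j < k.+1) c (grid_point k j)) =
    (fun k => (b - a)^-1 * ((b - a) / k.+1%:R *
       \sum_(j < k.+1) c (grid_point k j.+1)) + harmonic k * (c a - c b)).
  apply/funext => k; rewrite !mulrA mulVf ?gt_eqF ?subr_gt0 // mul1r /harmonic /=.
  rewrite -mulrDr; congr (_ * _).
  rewrite big_ord_recl grid_point0 [in RHS]big_ord_recr /= grid_point_last.
  rewrite (eq_bigr (fun i : 'I_k => c (grid_point k i.+1))) //; ring.
rewrite -Rintegral_itv_bndo_bndc // -[X in _ --> X]addr0; apply: cvgD.
  by apply: cvgM => //; exact: cvg_cst.
rewrite -(mul0r (c a - c b)).
by apply: cvgM; [exact: cvg_harmonic | exact: cvg_cst].
Qed.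

End RiemannSums.

(** * Expectations and sigma-algebras of events *)

Section Expectation.
Context {R : realType} {disp : measure_display} {T : measurableType disp}.
Variable P : probability T R.
Implicit Types (f g : T -> R) (G : set (set T)).

Definition Ex f : R := \int[P]_w f w.

Definition bounded_mfun f : Prop :=
  measurable_fun setT f /\ exists M : R, forall w, `|f w| <= M.

Lemma bounded_mfun_integrable f : bounded_mfun f ->
  P.-integrable setT (EFin \o f).
Proof.
move=> [mf [M fM]]; apply: measurable_bounded_integrable => //.
  by rewrite (le_lt_trans (probability_le1 P measurableT)) // ltry.
by exists M; split; [exact: num_real | move=> K MK w _ /=; rewrite (le_trans (fM w)) // ltW].
Qed.

Lemma bounded_mfun_cst (c : R) : bounded_mfun (fun=> c).
Proof. by split; [exact: measurable_cst | exists `|c|]. Qed.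

Lemma bounded_mfunD f g : bounded_mfun f -> bounded_mfun g ->
  bounded_mfun (fun w => f w + g w).
Proof.
move=> [mf [M fM]] [mg [K gK]]; split; first exact: measurable_funD.
by exists (M + K) => w; rewrite (le_trans (ler_normD _ _)) // lerD.
Qed.

Lemma bounded_mfunM f g : bounded_mfun f -> bounded_mfun g ->
  bounded_mfun (fun w => f w * g w).
Proof.
move=> [mf [M fM]] [mg [K gK]]; split; first exact: measurable_funM.
by exists (M * K) => w; rewrite normrM ler_pM.
Qed.

Lemma bounded_mfunB f g : bounded_mfun f -> bounded_mfun g ->
  bounded_mfun (fun w => f w - g w).
Proof.
move=> [mf [M fM]] [mg [K gK]]; split; first exact: measurable_funB.
by exists (M + K) => w; rewrite (le_trans (ler_normB _ _)) // lerD.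
Qed.

Lemma bounded_mfun_sum (I : Type) (s : seq I) (F : I -> T -> R) :
  (forall i, bounded_mfun (F i)) -> bounded_mfun (fun w => \sum_(i <- s) F i w).
Proof.
move=> mF; elim: s => [|i s IH].
  by under eq_fun do rewrite big_nil; exact: bounded_mfun_cst.
by under eq_fun do rewrite big_cons; exact: bounded_mfunD.
Qed.

Lemma bounded_mfun_indic (A : set T) : measurable A -> bounded_mfun \1_A.
Proof.
move=> mA; split; first exact: measurable_indic.
by exists 1 => w; rewrite indicE; case: (_ \in _); rewrite ?normr1 ?normr0.
Qed.

Lemma ExD f g : bounded_mfun f -> bounded_mfun g ->
  Ex (fun w => f w + g w) = Ex f + Ex g.
Proof. by move=> mf mg; apply: RintegralD => //; exact: bounded_mfun_integrable. Qed.

Lemma ExB f g : bounded_mfun f -> bounded_mfun g ->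
  Ex (fun w => f w - g w) = Ex f - Ex g.
Proof. by move=> mf mg; apply: RintegralB => //; exact: bounded_mfun_integrable. Qed.

Lemma ExZ (c : R) f : bounded_mfun f -> Ex (fun w => c * f w) = c * Ex f.
Proof. by move=> mf; apply: RintegralZl => //; exact: bounded_mfun_integrable. Qed.

Lemma Ex_cst (c : R) : Ex (fun=> c) = c.
Proof.
rewrite /Ex Rintegral_cst //; transitivity (c * fine 1%E); last exact: mulr1.
by congr (_ * fine _); exact: probability_setT.
Qed.

Lemma Ex_le f g : bounded_mfun f -> bounded_mfun g -> (forall w, f w <= g w) ->
  Ex f <= Ex g.
Proof. by move=> mf mg fg; apply: le_Rintegral => //; exact: bounded_mfun_integrable. Qed.

Lemma Ex_le_cst f (c : R) : bounded_mfun f -> (forall w, f w <= c) -> Ex f <= c.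
Proof.
by move=> mf fc; rewrite -(Ex_cst c) Ex_le //; exact: bounded_mfun_cst.
Qed.

Lemma Ex_ge0 f : (forall w, 0 <= f w) -> 0 <= Ex f.
Proof. by move=> f0; apply: Rintegral_ge0. Qed.

Lemma Ex_norm_le f (c : R) : bounded_mfun f -> (forall w, `|f w| <= c) ->
  `|Ex f| <= c.
Proof.
move=> mf fc; rewrite ler_norml; apply/andP; split.
  rewrite -(Ex_cst (- c)) Ex_le // ?bounded_mfun_cst // => [|w].
    exact: bounded_mfun_cst.
  by have := fc w; rewrite ler_norml => /andP[].
by apply: Ex_le_cst => // w; rewrite (le_trans (ler_norm _)).
Qed.

Lemma Ex_sum (I : Type) (s : seq I) (F : I -> T -> R) :
  (forall i, bounded_mfun (F i)) ->
  Ex (fun w => \sum_(i <- s) F i w) = \sum_(i <- s) Ex (F i).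
Proof.
move=> mF; elim: s => [|i s IH].
  by rewrite big_nil; under [X in Ex X]eq_fun do rewrite big_nil; exact: Ex_cst.
rewrite big_cons -IH; under [X in Ex X]eq_fun do rewrite big_cons.
by rewrite ExD //; exact: bounded_mfun_sum.
Qed.

Lemma Ex_cvg (f_ : nat -> T -> R) f (M : R) :
  (forall k, measurable_fun setT (f_ k)) -> (forall k w, `|f_ k w| <= M) ->
  (forall w, f_ k w @[k --> \oo] --> f w) -> Ex (f_ k) @[k --> \oo] --> Ex f.
Proof.
move=> mf_ fM ff.
have bf_ k : bounded_mfun (f_ k) by split=> //; exists M.
have bf : bounded_mfun f.
  split; first by apply: (measurable_fun_cvg mf_) => w _; exact: ff.
  exists M => w; apply: (cvgr_to_le (cvg_norm (ff w))).
  by apply: nearW => k; exact: fM.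
have cv : (\int[P]_w (f_ k w)%:E @[k --> \oo] --> \int[P]_w (f w)%:E)%E.
  apply: (@dominated_cvg _ _ _ P _ measurableT (fun k w => (f_ k w)%:E)
    (EFin \o f) (cst M%:E)) => //.
  - by move=> k; apply/measurable_EFinP.
  - by move=> w _; apply: cvg_EFin; [exact: nearW | exact: ff].
  - exact: (bounded_mfun_integrable (bounded_mfun_cst M)).
  - by move=> k w _; rewrite /= lee_fin.
apply: (@fine_cvg _ _ _ _ (fun k => \int[P]_w (f_ k w)%:E)%E).
rewrite /Ex /Rintegral fineK //.
exact/integrable_fin_num/bounded_mfun_integrable.
Qed.

(** Measurability for a sub-sigma-algebra is measurability on a copy of the
sample space that carries the sigma-algebra generated by [G]. *)
Definition determined_by G f : Prop :=
  @measurable_fun _ _ (g_sigma_algebraType G) _ setT (f : g_sigma_algebraType G -> R).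

Lemma determined_by_measurable G f : G `<=` measurable ->
  determined_by G f -> measurable_fun setT f.
Proof.
move=> Gm mf _ A mA; rewrite setTI.
have : <<s G >> (f @^-1` A) by have := mf measurableT A mA; rewrite setTI.
by apply: smallest_sub => //; exact: sigma_algebra_measurable.
Qed.

Lemma sub_determined_by G G' f : G `<=` G' ->
  determined_by G f -> determined_by G' f.
Proof.
move=> GG' mf _ A mA; rewrite setTI.
have : <<s G >> (f @^-1` A) by have := mf measurableT A mA; rewrite setTI.
exact: sub_sigma_algebra2.
Qed.

(** The sum counts the integers in [1, z], that is, it is the integral part of
[z]. *)
Lemma unary_approx (k : nat) (z : R) : 0 <= z <= k%:R ->
  `|z - \sum_(j < k) ((j.+1%:R <= z)%R)%:R| <= 1.
Proof.
elim: k => [|k IH] /andP[z0 zk].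
  have -> : z = 0 by apply/le_anti; rewrite z0 zk.
  by rewrite big_ord0 subrr normr0.
have [zk'|kz] := leP z k%:R.
  rewrite big_ord_recr /=.
  rewrite (_ : (k.+1%:R <= z) = false) ?addr0 ?IH ?z0 //.
  by apply/negP => /(le_trans)/(_ zk'); rewrite ler_nat ltnn.
have sumk : \sum_(j < k) ((j.+1%:R <= z)%R)%:R = k%:R :> R.
  rewrite (eq_bigr (fun=> 1)) ?sumr_const ?card_ord // => j _.
  by rewrite (le_trans _ (ltW kz)) // ler_nat.
rewrite big_ord_recr /= sumk ler_norml; move: zk kz; rewrite -[k.+1%:R]natr1.
by case: (_ <= z) => /= zk kz; apply/andP; split; lra.
Qed.

Section Orthogonality.
Variables (G : set (set T)) (W : T -> R).
Hypotheses (GT : G `<=` measurable) (mW : bounded_mfun W)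
  (orth : forall H, <<s G >> H -> Ex (fun w => \1_H w * W w) = 0).

(** Layer-cake approximation: [k Y] is within [1] of the sum of the indicators of
the events [j <= k Y], [1 <= j <= k], which belong to the sigma-algebra.  Hence
[k |E (Y W)|] is bounded independently of [k]. *)
Lemma orthogonal_unit (Y : T -> R) : determined_by G Y ->
  (forall w, 0 <= Y w <= 1) -> Ex (fun w => Y w * W w) = 0.
Proof.
move=> dY Y01; have mY := determined_by_measurable GT dY.
have bY : bounded_mfun Y.
  by split=> //; exists 1 => w; have /andP[y0 y1] := Y01 w; rewrite ger0_norm.
have [_ [M WM]] := mW.
pose H (k j : nat) : set T := [set w | j.+1%:R <= k%:R * Y w].
have sH k j : <<s G >> (H k j).
  have mkY : determined_by G (fun w => k%:R * Y w) by exact: measurable_funM.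
  have := mkY measurableT `[j.+1%:R, +oo[%classic (measurable_itv _).
  rewrite setTI; congr (<<s _ >> _).
  by apply/seteqP; split=> w /=; rewrite /H in_itv /= andbT.
have mH k j : measurable (H k j).
  by have := sH k j; apply: smallest_sub => //; exact: sigma_algebra_measurable.
pose Yk k w : R := \sum_(j < k) \1_(H k j) w.
have bYk k : bounded_mfun (Yk k).
  by apply: bounded_mfun_sum => j; exact: bounded_mfun_indic.
have EYk k : Ex (fun w => Yk k w * W w) = 0.
  have -> : (fun w => Yk k w * W w) = (fun w => \sum_(j < k) \1_(H k j) w * W w).
    by apply/funext => w; rewrite mulr_suml.
  rewrite Ex_sum; last by move=> j; apply: bounded_mfunM => //; exact: bounded_mfun_indic.
  by apply: big1 => j _; exact: orth.
have approx k w : `|k%:R * Y w - Yk k w| <= 1.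
  rewrite /Yk (eq_bigr (fun j : 'I_k => ((j.+1%:R <= k%:R * Y w)%R)%:R)); last first.
    move=> j _; rewrite indicE; congr (_%:R); congr nat_of_bool.
    by apply/idP/idP => [/set_mem|] //= h; exact/mem_set.
  apply: unary_approx; have /andP[y0 y1] := Y01 w.
  by rewrite mulr_ge0 //= ler_piMr.
have bound k : k%:R * `|Ex (fun w => Y w * W w)| <= M.
  rewrite -[k%:R]ger0_norm // -normrM -ExZ; last exact: bounded_mfunM.
  rewrite -[X in `|X|]subr0 -(EYk k) -ExB; last 2 first.
  - by apply: bounded_mfunM; [exact: bounded_mfun_cst | exact: bounded_mfunM].
  - exact: bounded_mfunM.
  apply: Ex_norm_le.
    apply: bounded_mfunB; last exact: bounded_mfunM.
    by apply: bounded_mfunM; [exact: bounded_mfun_cst | exact: bounded_mfunM].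
  move=> w; rewrite mulrA -mulrBl normrM -[M]mul1r.
  by rewrite ler_pM.
apply/eqP; rewrite -normr_eq0; apply/negP => /negP n0.
have e0 : 0 < `|Ex (fun w => Y w * W w)| by rewrite lt_def n0 normr_ge0.
have M0 : 0 <= M by have := bound 0%N; rewrite mul0r.
have := bound (Num.trunc (M / `|Ex (fun w => Y w * W w)|)).+1.
rewrite leNgt => /negP; apply.
by rewrite -ltr_pdivrMr // truncnS_gt.
Qed.

(** An affine change of variable maps the values of [Y] into [[0, 1]]. *)
Lemma orthogonal_determined (Y : T -> R) (M : R) : determined_by G Y ->
  (forall w, `|Y w| <= M) -> Ex (fun w => Y w * W w) = 0.
Proof.
move=> dY YM.
pose K : R := `|M| + 1; have K0 : 0 < K by rewrite ltr_wpDl.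
have YK w : `|Y w| <= K.
  by rewrite (le_trans (YM w)) // (le_trans (ler_norm _)) // lerDl.
pose U w := (Y w + K) / (2 * K).
have dU : determined_by G U.
  by apply: measurable_funM => //; apply: measurable_funD.
have U01 w : 0 <= U w <= 1.
  have := YK w; rewrite ler_norml => /andP[y0 y1].
  rewrite /U divr_ge0 ?mulr_ge0 ?(ltW K0) //=; last by lra.
  by rewrite ler_pdivrMr ?mulr_gt0 //; lra.
have bU : bounded_mfun U.
  split; first exact: determined_by_measurable dU.
  by exists 1 => w; have /andP[y0 y1] := U01 w; rewrite ger0_norm.
have E1 : Ex (fun w => U w * W w) = 0 by exact: orthogonal_unit.
have E2 : Ex W = 0.
  have := orth (@measurableT _ (g_sigma_algebraType G)); congr (_ = 0); congr Ex.
  by apply/funext => w; rewrite indicT mul1r.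
have -> : (fun w => Y w * W w) = (fun w => (2 * K) * (U w * W w) - K * W w).
  apply/funext => w; rewrite /U; field; rewrite gt_eqF //.
rewrite ExB; last 2 first.
- by apply: bounded_mfunM; [exact: bounded_mfun_cst | exact: bounded_mfunM].
- by apply: bounded_mfunM => //; exact: bounded_mfun_cst.
by rewrite !ExZ ?E1 ?E2 ?mulr0 ?subrr //; exact: bounded_mfunM.
Qed.

End Orthogonality.

End Expectation.

(** * Measurability with respect to the history *)

Section ModelMeasurability.
Context {R : realType} {N d : nat}.
Variables (A : 'M[R]_(N, d)) (b : 'cV[R]_N) (Q : 'cV[R]_d -> 'M[R]_N).
Hypothesis hQ : product_form_network A b Q.
Context {dT : measure_display} {T : measurableType dT}.
Variable r : T -> 'cV[R]_d.
Hypothesis mr : mx_measurable r.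

Lemma product_form_measurable : mx_measurable (fun w => product_form A b (r w)).
Proof.
have mexp x : measurable_fun setT (fun w => expR ((A *m r w + b) x 0)).
  apply: (measurableT_comp (@measurable_expR R)).
  under eq_fun do rewrite mxE; apply: measurable_funD => //.
  by apply: (mx_measurable_mul (M := fun=> A)) => // i j; exact: measurable_cst.
move=> x j; rewrite (ord1 j).
under eq_fun do rewrite product_formE partition_functionE.
by apply: measurable_funM => //; apply: measurable_fun_inv; exact: measurable_sum.
Qed.

(** Each off-diagonal rate is constant or the exponential of a coordinate; the
diagonal is determined by the vanishing row sums. *)
Lemma generator_measurable : mx_measurable (fun w => Q (r w)).
Proof.
have off x y : x != y -> measurable_fun setT (fun w => Q (r w) x y).
  move=> xy; have [[i Qi]|Qf] := rate_cases hQ xy.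
    under eq_fun do rewrite Qi.
    by apply: (measurableT_comp (@measurable_expR R)); exact: mr.
  by under eq_fun do rewrite Qf; exact: measurable_cst.
move=> x y; have [->|] := eqVneq x y; last exact: off.
have -> : (fun w => Q (r w) y y) =
    (fun w => - \sum_z (if z == y then 0 else Q (r w) y z)).
  apply/funext => w; have /eqP := (pfn_generator hQ (r w)).2 y.
  rewrite (bigD1 y) //= addr_eq0 => /eqP ->.
  rewrite [in RHS](bigD1 y) //= eqxx add0r; congr (- _).
  by apply: eq_bigr => z /negbTE ->.
apply: measurable_funN; apply: measurable_sum => z.
have [_|zy] := eqVneq z y; first exact: measurable_cst.
by apply: off; rewrite eq_sym.
Qed.

End ModelMeasurability.

Section History.
Context {R : realType} {N d : nat} {disp : measure_display}
  {T : measurableType disp}.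
Variables (A : 'M[R]_(N, d)) (Q : 'cV[R]_d -> 'M[R]_N) (gamma : 'cV[R]_d)
  (P : probability T R) (t : nat -> R) (ht : observation_times t)
  (a : nat -> R) (X0 : T -> 'I_N) (Z : nat -> R -> T -> 'I_N)
  (r0 : 'cV[R]_d) (Rn : nat -> T -> 'cV[R]_d)
  (hZ : online_process P t Q X0 Z Rn)
  (hRn : online_algorithm t A gamma r0 a Z Rn).

(** These events generate [history], which is [<<s observed n s >>] by
conversion. *)
Definition observed (n : nat) (s : R) : set (set T) :=
  [set B | exists m v x, [/\ (m <= n)%N, in_period t m v, v <= s &
                           B = [set w | Z m v w = x]]].

Lemma observed_measurable n s : observed n s `<=` measurable.
Proof. by move=> _ [m [v [x [_ mv _ ->]]]]; exact: (op_measurable hZ). Qed.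

Lemma observed_mono n n' s s' : (n <= n')%N -> s <= s' ->
  observed n s `<=` observed n' s'.
Proof.
move=> nn' ss' B [m [v [x [mn mv vs ->]]]]; exists m, v, x; split=> //.
  exact: leq_trans nn'.
exact: le_trans ss'.
Qed.

Lemma times_le m n : (m <= n)%N -> t m <= t n.
Proof.
move=> /subnK <-; elim: (n - m)%N => [//|k IH].
by rewrite addSn (le_trans IH) // ltW //; case: ht.
Qed.

Lemma state_determined n s m v (F : T -> 'I_N -> R) :
  (m <= n)%N -> in_period t m v -> v <= s ->
  (forall y, determined_by (observed n s) (F ^~ y)) ->
  determined_by (observed n s) (fun w => F w (Z m v w)).
Proof.
move=> mn mv vs dF.
have -> : (fun w => F w (Z m v w)) =
    (fun w => \sum_y F w y * \1_[set w' | Z m v w' = y] w).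
  apply/funext => w; rewrite (bigD1 (Z m v w)) //= indicE mem_set // mulr1.
  rewrite big1 ?addr0 // => y yZ; rewrite indicE memNset ?mulr0 //=.
  by move=> Zy; move: yZ; rewrite Zy eqxx.
apply: measurable_sum => y; apply: measurable_funM; first exact: dF.
apply: measurable_indic; apply: sub_gen_smallest.
by exists m, v, y.
Qed.

Let grid n := grid_point (t n) (t n.+1).

Lemma grid_in_period n k j : (j <= k.+1)%N -> in_period t n (grid n k j).
Proof.
have tn : t n < t n.+1 by case: ht.
move=> jk; apply/andP; split.
  by rewrite -(grid_point0 (t n) (t n.+1) k) grid_point_le.
by rewrite -[leRHS](grid_point_last (t n) (t n.+1) k) grid_point_le.
Qed.

Definition state_mean n x k w : R :=
  (k.+1%:R)^-1 * \sum_(j < k.+1) (Z n (grid n k j) w == x)%:R.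

Lemma occupation_cvg n w x : state_mean n x k w @[k --> \oo] -->
  occupation t Z n w x 0.
Proof.
have tn : t n < t n.+1 by case: ht.
pose c : R -> R := \1_[set s | Z n s w = x].
have cE s : c s = (Z n s w == x)%:R.
  rewrite /c indicE; congr (nat_of_bool _)%:R.
  by apply/idP/eqP => [/set_mem|] // h; exact: mem_set.
have c0 s : 0 <= c s by rewrite cE.
have c1 s : c s <= 1 by rewrite cE; case: eqP.
have cr s : t n <= s < t n.+1 -> \forall v \near s^'+, c v = c s.
  by move=> /(op_right_continuous hZ w); apply: filterS => v Zv; rewrite !cE Zv.
rewrite /occupation mxE.
have := riemann_sum_cvg tn c0 c1 cr.
by under eq_fun do under eq_bigr do rewrite cE.
Qed.

Lemma state_mean_bounds n x k w : 0 <= state_mean n x k w <= 1.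
Proof.
rewrite /state_mean mulr_ge0 ?sumr_ge0 //= mulrC ler_pdivrMr // mul1r.
apply: le_trans (_ : \sum_(j < k.+1) 1 <= _); last by rewrite sumr_const card_ord.
by apply: ler_sum => j _; case: eqP.
Qed.

Lemma occupation_bounds n w x : 0 <= occupation t Z n w x 0 <= 1.
Proof.
have /cvgr_to_ge ge := @occupation_cvg n w x.
have /cvgr_to_le le := @occupation_cvg n w x.
by apply/andP; split; [apply: ge | apply: le]; apply: nearW => k; case/andP: (state_mean_bounds n x k w).
Qed.

Lemma state_mean_determined n m s x k : (m <= n)%N -> t m.+1 <= s ->
  determined_by (observed n s) (state_mean m x k).
Proof.
move=> mn ms; apply: measurable_funM => //; apply: measurable_sum => j.
have jk : (j <= k.+1)%N by exact/ltnW/ltn_ord.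
apply: (state_determined (F := fun w y => (y == x)%:R)) => //.
- exact: grid_in_period.
- apply: le_trans ms; rewrite -[leRHS](grid_point_last (t m) (t m.+1) k).
  by rewrite grid_point_le //; case: ht.
- by move=> y; exact: measurable_cst.
Qed.

(** Occupation fractions are pointwise limits of averages over grid points, all
of which belong to the past. *)
Lemma occupation_determined n m s x : (m <= n)%N -> t m.+1 <= s ->
  determined_by (observed n s) (fun w => occupation t Z m w x 0).
Proof.
move=> mn ms.
apply: (@measurable_fun_cvg _ (g_sigma_algebraType (observed n s)) R setT
  (state_mean m x)); last by move=> w _; exact: occupation_cvg.
by move=> k; exact: state_mean_determined.
Qed.

Lemma iterate_determined n i : determined_by (observed n (t n)) (fun w => Rn n w i 0).
Proof.
elim: n i => [|n IH] i.
  by rewrite /determined_by; under eq_fun do rewrite hRn.1; exact: measurable_cst.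
have -> : (fun w => Rn n.+1 w i 0) = (fun w => Rn n w i 0 - a n.+1 *
    (\sum_x A x i * occupation t Z n w x 0 - gamma i 0)).
  apply/funext => w; rewrite hRn.2 !mxE; congr (_ - _ * (_ - _)).
  by apply: eq_bigr => x _; rewrite !mxE.
apply: measurable_funB.
  by apply: sub_determined_by (IH i); apply: observed_mono => //; exact: times_le.
apply: measurable_funM => //; apply: measurable_funB => //.
apply: measurable_sum => x; apply: measurable_funM => //.
exact: occupation_determined.
Qed.

Lemma iterate_determined_later n s : in_period t n s ->
  @mx_measurable R _ (g_sigma_algebraType (observed n s)) _ _ (Rn n).
Proof.
move=> /andP[ns _] i j; rewrite (ord1 j).
exact: (sub_determined_by (observed_mono (leqnn n) ns) (@iterate_determined n i)).
Qed.

Definition max_increment : R := \sum_i (\sum_x `|A x i| + `|gamma i 0|).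

Lemma max_increment_ge0 : 0 <= max_increment.
Proof. by apply: sumr_ge0 => i _; rewrite addr_ge0 // sumr_ge0. Qed.

Lemma increment_norm1 n w :
  norm1 (A^T *m occupation t Z n w - gamma) <= max_increment.
Proof.
apply: ler_sum => i _; rewrite 3!mxE; apply: le_trans (ler_normB _ _) _.
rewrite lerD2r; apply: le_trans (ler_norm_sum _ _ _) _; apply: ler_sum => x _.
rewrite mxE normrM ler_piMr //; have /andP[p0 p1] := occupation_bounds n w x.
by rewrite ger0_norm.
Qed.

Hypothesis ha : forall n, (0 < n)%N -> 0 < a n.

(** Occupation fractions lie in [[0, 1]], so each step of the algorithm is
bounded by a constant times its step size, whatever the path does. *)
Lemma iterate_norm1 n w :
  norm1 (Rn n w) <= norm1 r0 + max_increment * \sum_(1 <= m < n.+1) a m.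
Proof.
elim: n => [|n IH]; first by rewrite hRn.1 big_geq // mulr0 addr0.
rewrite big_nat_recr //= mulrDr addrA; apply: le_trans (lerD IH (lexx _)).
apply: le_trans (_ : norm1 (Rn n w) +
    a n.+1 * norm1 (A^T *m occupation t Z n w - gamma) <= _); last first.
  by rewrite lerD2l mulrC ler_wpM2r ?increment_norm1 // ltW // ha.
rewrite /norm1 mulr_sumr -big_split; apply: ler_sum => i _.
have -> : Rn n.+1 w i 0 =
    Rn n w i 0 - a n.+1 * (A^T *m occupation t Z n w - gamma) i 0.
  by rewrite hRn.2; set M := _ - gamma; rewrite !mxE.
apply: le_trans (ler_normB _ _) _; rewrite /= lerD2l normrM.
by rewrite (gtr0_norm (ha _)).
Qed.

End History.

(** * The Markov property as an identity of expectations *)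

Section DeviationOfNetwork.
Context {R : realType} {N d : nat}.
Variables (A : 'M[R]_(N, d)) (b : 'cV[R]_N) (Q : 'cV[R]_d -> 'M[R]_N).
Hypothesis hQ : product_form_network A b Q.
Let pi := product_form A b.

Lemma edge_flow_gt0 r : exists2 m : R, 0 < m &
  forall x y, x != y -> 0 < Q r x y -> m <= pi r x 0 * Q r x y.
Proof.
exists (\big[Num.min/1]_(z : 'I_N * 'I_N | 0 < Q r z.1 z.2) (pi r z.1 0 * Q r z.1 z.2)).
  by apply: lt_bigmin => // z Qz; rewrite mulr_gt0 ?product_form_gt0.
by move=> x y _ Qxy; apply: (bigmin_le_cond _ (j := (x, y))).
Qed.

Lemma network_bordered_unit r :
  Q r - (const_mx 1 : 'cV[R]_N) *m (pi r)^T \in unitmx.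
Proof.
have [m m0 mQ] := edge_flow_gt0 r.
exact: (bordered_generator_unit (pfn_generator hQ r)
  (@pfn_irreducible _ _ _ _ _ _ hQ r) (pfn_steady_state hQ r) m0 mQ).
Qed.

Lemma network_poisson r (phi : 'cV[R]_N) : (pi r)^T *m phi = 0 ->
  Q r *m (deviation_mx (Q r) (pi r) *m phi) = phi.
Proof.
move=> pphi; have [m m0 mQ] := edge_flow_gt0 r.
have [+ _] := poisson_equation (pfn_generator hQ r)
  (@pfn_irreducible _ _ _ _ _ _ hQ r) (pfn_steady_state hQ r) m0 mQ pphi.
by rewrite mulmxN => /oppr_inj.
Qed.

(** The centred indicator of [x], whose average along the path is the estimation
error of [pi x]. *)
Definition centered (x : 'I_N) r : 'cV[R]_N := \col_z ((z == x)%:R - pi r x 0).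

Lemma centered_mean x r : (pi r)^T *m centered x r = 0.
Proof.
apply/matrixP => i j; rewrite !ord1 mxE [RHS]mxE.
rewrite (eq_bigr (fun z => pi r z 0 * (z == x)%:R - pi r z 0 * pi r x 0)); last first.
  by move=> z _; rewrite !mxE mulrBr.
rewrite sumrB -mulr_suml (product_form_sum A b x) mul1r (bigD1 x) //= eqxx mulr1.
by rewrite big1 ?addr0 ?subrr // => z /negbTE ->; rewrite mulr0.
Qed.

Lemma centered_le1 x r z : `|centered x r z 0| <= 1.
Proof.
have p0 := ltW (product_form_gt0 A b r x); have p1 := product_form_le1 A b r x.
rewrite mxE /pi ler_norml; case: (z == x) => /=; apply/andP; split; lra.
Qed.

Definition potential (x : 'I_N) r : 'cV[R]_N :=
  deviation_mx (Q r) (pi r) *m centered x r.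

Lemma potential_poisson x r : Q r *m potential x r = centered x r.
Proof. exact/network_poisson/centered_mean. Qed.

Context {dT : measure_display} {T : measurableType dT} (rho : T -> 'cV[R]_d).
Hypothesis mrho : mx_measurable rho.

Lemma centered_measurable x : mx_measurable (fun w => centered x (rho w)).
Proof.
move=> z j; rewrite (ord1 j); under eq_fun do rewrite mxE.
apply: measurable_funB => //.
exact: (product_form_measurable A b mrho).
Qed.

Lemma potential_measurable x : mx_measurable (fun w => potential x (rho w)).
Proof.
apply: mx_measurable_mul; last exact: centered_measurable.
apply: mx_measurable_inv => [w|]; first exact: network_bordered_unit.
move=> i j; under eq_fun do rewrite mxE.
apply: measurable_funD; first exact: (generator_measurable hQ mrho).
under eq_fun do rewrite mxE; apply: measurable_funN.
apply: mx_measurable_mul => [k l|k l]; first exact: measurable_cst.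
by under eq_fun do rewrite mxE; exact: (product_form_measurable A b mrho).
Qed.

End DeviationOfNetwork.

(** From here on the iterate of period [n] has its rates bounded by a
deterministic [q]; conditionally on the past the process of period [n] is then a
chain with a fixed, bounded generator. *)
Section PeriodTransitions.
Context {R : realType} {N d : nat} {disp : measure_display}
  {T : measurableType disp}.
Variables (A : 'M[R]_(N, d)) (b : 'cV[R]_N) (Q : 'cV[R]_d -> 'M[R]_N)
  (hQ : product_form_network A b Q) (gamma : 'cV[R]_d)
  (P : probability T R) (t : nat -> R) (ht : observation_times t)
  (a : nat -> R) (X0 : T -> 'I_N) (Z : nat -> R -> T -> 'I_N)
  (r0 : 'cV[R]_d) (Rn : nat -> T -> 'cV[R]_d)
  (hZ : online_process P t Q X0 Z Rn)
  (hRn : online_algorithm t A gamma r0 a Z Rn).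
Variables (n : nat) (q : R).
Hypothesis Qq : forall w x y, `|Q (Rn n w) x y| <= q.
Let E := Ex P.
Let known (s : R) (f : T -> R) := determined_by (observed t Z n s) f.

Let mRn s : in_period t n s ->
  @mx_measurable R _ (g_sigma_algebraType (observed t Z n s)) _ _ (Rn n).
Proof. exact: (iterate_determined_later ht hZ hRn). Qed.

Lemma known_bounded s f (M : R) : known s f -> (forall w, `|f w| <= M) ->
  bounded_mfun f.
Proof.
move=> kf fM; split; last by exists M.
by apply: determined_by_measurable kf; exact: (observed_measurable hZ).
Qed.

Lemma known_mono s s' f : s <= s' -> known s f -> known s' f.
Proof. by move=> ss'; apply: sub_determined_by; exact: observed_mono. Qed.

Lemma known_state s (F : T -> 'I_N -> R) : in_period t n s ->
  (forall y, known s (F ^~ y)) -> known s (fun w => F w (Z n s w)).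
Proof. by move=> ns kF; apply: state_determined. Qed.

Definition transition (h : R) w : 'M[R]_N := expmx (h *: Q (Rn n w)).

Lemma transition_known s h y : in_period t n s ->
  known s (fun w => transition h w (Z n s w) y).
Proof.
move=> ns; apply: (known_state (F := fun w z => transition h w z y)) => // z.
have := mx_measurable_expmx (M := fun w : g_sigma_algebraType (observed t Z n s) =>
  h *: Q (Rn n w)).
apply => i j; under eq_fun do rewrite mxE.
by apply: measurable_funM => //; exact: (generator_measurable hQ (mRn ns)).
Qed.

Lemma transition_first_order h w x y : 0 <= h <= 1 ->
  `|transition h w x y - (x == y)%:R - h * Q (Rn n w) x y| <=
  h ^+ 2 * expR (N%:R * q).
Proof. by move=> h01; apply: expmx_first_order. Qed.

Lemma transition_bounded h w x y : 0 <= h <= 1 ->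
  `|transition h w x y| <= 1 + q + expR (N%:R * q).
Proof.
move=> h01; have /andP[h0 h1] := h01.
have := transition_first_order w x y h01; set p := transition h w x y => le.
have -> : p = (p - (x == y)%:R - h * Q (Rn n w) x y) + (x == y)%:R + h * Q (Rn n w) x y.
  by ring.
rewrite (le_trans (ler_normD _ _)) // (le_trans (lerD (ler_normD _ _) (lexx _))) //.
rewrite addrC addrA addrAC lerD //.
  rewrite addrC lerD //; first by case: (x == y); rewrite ?normr1 ?normr0.
  by rewrite normrM ger0_norm // -[q]mul1r ler_pM.
by rewrite (le_trans le) // ler_piMl ?expR_ge0 // exprn_ile1.
Qed.

(** For each state [y], the difference of the indicator of [Z u = y] and its
conditional probability is orthogonal to the events of the history at time [s],
hence to the random variable [F w y]. *)
Lemma expectation_transition s u (F : T -> 'I_N -> R) (M : R) :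
  in_period t n s -> in_period t n u -> s <= u -> u - s <= 1 ->
  (forall y, known s (F ^~ y)) -> (forall w y, `|F w y| <= M) ->
  E (fun w => F w (Z n u w)) =
  E (fun w => \sum_y F w y * transition (u - s) w (Z n s w) y).
Proof.
move=> ns nu su us1 kF FM.
have us0 : 0 <= u - s by rewrite subr_ge0.
have obs := observed_measurable hZ.
have bF y : bounded_mfun (F ^~ y) by exact: (known_bounded (kF y) (FM^~ y)).
pose B y : set T := [set w | Z n u w = y].
have mB y : measurable (B y) by exact: (op_measurable hZ).
pose kappa y w := transition (u - s) w (Z n s w) y.
have bk y : bounded_mfun (kappa y).
  apply: (known_bounded (transition_known (u - s) y ns)) => w.
  by apply: transition_bounded; rewrite us0.
have -> : (fun w => F w (Z n u w)) = (fun w => \sum_y F w y * \1_(B y) w).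
  apply/funext => w; rewrite (bigD1 (Z n u w)) //= indicE mem_set // mulr1.
  rewrite big1 ?addr0 // => y yZ; rewrite indicE memNset ?mulr0 //=.
  by move=> Zy; move: yZ; rewrite -Zy eqxx.
rewrite /E !Ex_sum; last 2 first.
- by move=> y; exact: (bounded_mfunM (bF y) (bk y)).
- by move=> y; exact: (bounded_mfunM (bF y) (bounded_mfun_indic (mB y))).
apply: eq_bigr => y _; apply/eqP; rewrite -subr_eq0 -ExB; last 2 first.
- exact: (bounded_mfunM (bF y) (bounded_mfun_indic (mB y))).
- exact: (bounded_mfunM (bF y) (bk y)).
have -> : (fun w => F w y * \1_(B y) w - F w y * transition (u - s) w (Z n s w) y) =
    (fun w => F w y * (\1_(B y) w - kappa y w)).
  by apply/funext => w; rewrite mulrBr.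
apply/eqP; apply: (orthogonal_determined _ _ _ (kF y) (FM^~ y)).
- exact: obs.
- by apply: bounded_mfunB => //; exact: bounded_mfun_indic.
move=> H hH; have mH : measurable H.
  by apply: smallest_sub hH; [exact: sigma_algebra_measurable | exact: obs].
have bH : bounded_mfun (\1_H : T -> R) by exact: bounded_mfun_indic.
have -> : (fun w => \1_H w * (\1_(B y) w - kappa y w)) =
    (fun w => \1_(H `&` B y) w - \1_H w * kappa y w).
  by apply/funext => w; rewrite mulrBr indicI.
rewrite ExB; last 2 first.
- by apply: bounded_mfun_indic; exact: measurableI.
- exact: (bounded_mfunM bH (bk y)).
have := op_markov hZ y ns nu su hH; rewrite -/(B y) => PE.
have -> : Ex P \1_(H `&` B y) = fine (P (H `&` B y)).
  by rewrite /Ex /Rintegral integral_indic ?setIT //; exact: measurableI.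
rewrite PE; apply/eqP; rewrite subr_eq0; apply/eqP.
rewrite -[LHS]/(\int[P]_(w in H) kappa y w) Rintegral_mkcond.
apply: eq_Rintegral => w _; rewrite patchE indicE.
by case: (w \in H); rewrite ?mul1r ?mul0r.
Qed.

End PeriodTransitions.

(** * Variance of the occupation estimates *)

Section OccupationVariance.
Context {R : realType} {N d : nat} {disp : measure_display}
  {T : measurableType disp}.
Variables (A : 'M[R]_(N, d)) (b : 'cV[R]_N) (Q : 'cV[R]_d -> 'M[R]_N)
  (hQ : product_form_network A b Q) (gamma : 'cV[R]_d)
  (P : probability T R) (t : nat -> R) (ht : observation_times t)
  (a : nat -> R) (X0 : T -> 'I_N) (Z : nat -> R -> T -> 'I_N)
  (r0 : 'cV[R]_d) (Rn : nat -> T -> 'cV[R]_d)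
  (hZ : online_process P t Q X0 Z Rn)
  (hRn : online_algorithm t A gamma r0 a Z Rn).
Variables (n : nat) (q : R).
Hypothesis Qq : forall w x y, `|Q (Rn n w) x y| <= q.
Let E := Ex P.
Let known (s : R) (f : T -> R) := determined_by (observed t Z n s) f.
Let mRn s : in_period t n s ->
  @mx_measurable R _ (g_sigma_algebraType (observed t Z n s)) _ _ (Rn n).
Proof. exact: (iterate_determined_later ht hZ hRn). Qed.

Variables (x : 'I_N) (V : R).
Hypothesis potential_le : forall w z, `|potential A b Q x (Rn n w) z 0| <= V.
Let phi w z := centered A b x (Rn n w) z 0.
Let g w z := potential A b Q x (Rn n w) z 0.

Let g_le w z : `|g w z| <= V. Proof. exact: potential_le. Qed.
Let phi_le w z : `|phi w z| <= 1. Proof. exact: centered_le1. Qed.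

Let V0 : 0 <= V.
Proof. by apply: le_trans (potential_le point x). Qed.

Let known_phi s z : in_period t n s -> known s (phi ^~ z).
Proof. by move=> ns; exact: (centered_measurable A b (mRn ns) x z 0). Qed.

Let known_g s z : in_period t n s -> known s (g ^~ z).
Proof. by move=> ns; exact: (potential_measurable hQ (mRn ns) x z 0). Qed.

(** The conditional mean of [g(Z_u)] is [exp((u - s) Q) g] at [Z_s], whose
first-order expansion is [g + (u - s) Q g = g + (u - s) phi]. *)
Lemma potential_increment s u (Y : T -> R) (M : R) :
  in_period t n s -> in_period t n u -> s <= u -> u - s <= 1 ->
  known s Y -> (forall w, `|Y w| <= M) ->
  `|E (fun w => Y w * (g w (Z n u w) - g w (Z n s w) - (u - s) * phi w (Z n s w)))| <=
  M * ((u - s) ^+ 2 * (N%:R * expR (N%:R * q) * V)).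
Proof.
move=> ns nu su us1 kY YM.
have us0 : 0 <= u - s by rewrite subr_ge0.
have kYg y : known s (fun w => Y w * g w y).
  by apply: measurable_funM; [exact: kY | exact: known_g].
have YgM w y : `|Y w * g w y| <= M * V by rewrite normrM ler_pM.
have kgs : known s (fun w => g w (Z n s w)).
  by apply: known_state => // y; exact: known_g.
have kps : known s (fun w => phi w (Z n s w)).
  by apply: known_state => // y; exact: known_phi.
have ktr y : known s (fun w => transition Q Rn n (u - s) w (Z n s w) y).
  exact: (transition_known hQ ht hZ hRn).
pose D w := \sum_y g w y * transition Q Rn n (u - s) w (Z n s w) y
   - g w (Z n s w) - (u - s) * phi w (Z n s w).
have DE w : D w = \sum_y g w y * (transition Q Rn n (u - s) w (Z n s w) y
    - (Z n s w == y)%:R - (u - s) * Q (Rn n w) (Z n s w) y).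
  rewrite /D; have -> : phi w (Z n s w) = \sum_y Q (Rn n w) (Z n s w) y * g w y.
    by rewrite /phi -(potential_poisson hQ) mxE.
  have -> : g w (Z n s w) = \sum_y g w y * (Z n s w == y)%:R.
    rewrite (bigD1 (Z n s w)) //= eqxx mulr1 big1 ?addr0 // => y.
    by rewrite eq_sym => /negbTE ->; rewrite mulr0.
  rewrite mulr_sumr -!sumrB; apply: eq_bigr => y _; ring.
have D_le w : `|D w| <= (u - s) ^+ 2 * (N%:R * expR (N%:R * q) * V).
  rewrite DE; apply: le_trans (ler_norm_sum _ _ _) _.
  apply: le_trans (_ : \sum_(y < N) V * ((u - s) ^+ 2 * expR (N%:R * q)) <= _).
    apply: ler_sum => y _; rewrite normrM ler_pM //.
    by apply: transition_first_order => //; rewrite us0.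
  by rewrite sumr_const card_ord -mulr_natl le_eqVlt; apply/orP; left; apply/eqP; ring.
have kD : known s D.
  apply: measurable_funB; last by apply: measurable_funM => //; exact: kps.
  apply: measurable_funB; last exact: kgs.
  apply: measurable_sum => y; apply: measurable_funM; last exact: ktr.
  exact: known_g.
have bY : bounded_mfun Y by exact: (known_bounded hZ kY YM).
have bgs : bounded_mfun (fun w => g w (Z n s w)).
  by apply: (known_bounded hZ kgs) => w; exact: potential_le.
have bps : bounded_mfun (fun w => phi w (Z n s w)).
  by apply: (known_bounded hZ kps) => w; exact: centered_le1.
have bD : bounded_mfun D by exact: (known_bounded hZ kD D_le).
have kgu : known u (fun w => g w (Z n u w)).
  by apply: known_state => // y; exact: known_g.
have bgu : bounded_mfun (fun w => g w (Z n u w)).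
  by apply: (known_bounded hZ kgu) => w; exact: potential_le.
have btr y : bounded_mfun (fun w => transition Q Rn n (u - s) w (Z n s w) y).
  apply: (known_bounded hZ (ktr y)) => w.
  by apply: transition_bounded => //; rewrite us0.
have bg y : bounded_mfun (g ^~ y).
  by apply: (known_bounded hZ (known_g y ns)) => w; exact: potential_le.
have bsum : bounded_mfun (fun w => \sum_y g w y * transition Q Rn n (u - s) w (Z n s w) y).
  by apply: bounded_mfun_sum => y; exact: (bounded_mfunM (bg y) (btr y)).
have brest : bounded_mfun (fun w => g w (Z n s w) + (u - s) * phi w (Z n s w)).
  by apply: bounded_mfunD => //; apply: bounded_mfunM => //; exact: bounded_mfun_cst.
have EE : E (fun w => Y w * (g w (Z n u w) - g w (Z n s w) - (u - s) * phi w (Z n s w))) =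
    E (fun w => Y w * D w).
  have split (f : T -> R) : bounded_mfun f ->
      E (fun w => Y w * (f w - g w (Z n s w) - (u - s) * phi w (Z n s w))) =
      E (fun w => Y w * f w) - E (fun w => Y w * (g w (Z n s w) + (u - s) * phi w (Z n s w))).
    move=> bf; rewrite /E -ExB; [|exact: (bounded_mfunM bY bf)|exact: (bounded_mfunM bY brest)].
    by congr Ex; apply/funext => w; ring.
  rewrite (split _ bgu) (split _ bsum); congr (_ - _).
  rewrite /E (expectation_transition hQ ht hZ hRn Qq (F := fun w y => Y w * g w y) ns nu su us1 kYg YgM).
  by congr Ex; apply/funext => w; rewrite mulr_sumr; apply: eq_bigr => y _; rewrite mulrA.
rewrite EE; apply: Ex_norm_le; first exact: (bounded_mfunM bY bD).
by move=> w; rewrite normrM ler_pM.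
Qed.

Let h := t n.+1 - t n.
Let h0 : 0 < h. Proof. by rewrite subr_gt0; case: ht. Qed.
Let C := N%:R * expR (N%:R * q) * V.
Let C0 : 0 <= C. Proof. by rewrite !mulr_ge0 ?expR_ge0. Qed.

Section Grid.
Variable k : nat.
Let delta := h / k.+1%:R.
Hypothesis delta1 : delta <= 1.
Let delta0 : 0 < delta. Proof. by rewrite divr_gt0. Qed.
Let s j := grid_point (t n) (t n.+1) k j.
Let inp j : (j <= k.+1)%N -> in_period t n (s j).
Proof. exact: grid_in_period. Qed.
Let f j w := phi w (Z n (s j) w).
(* S j is the Riemann sum of phi over the first j cells, and L j is the square
   S j ^ 2 corrected so that its mean grows by O(delta) per cell: the cross term
   2 delta S j phi of the increment of S j ^ 2 is compensated, in mean, by the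
   increment of 2 S j g. *)
Let S j w := delta * \sum_(i < j) f i w.

Let tn : t n < t n.+1. Proof. by case: ht. Qed.

Let S_known j : (j <= k.+1)%N -> known (s j) (S j).
Proof.
move=> jk; apply: measurable_funM => //; apply: measurable_sum => i.
have ij : (i <= j)%N by exact/ltnW/ltn_ord.
have ik : (i <= k.+1)%N by exact: leq_trans jk.
apply: (@known_mono _ _ _ _ _ _ _ (s i) (s j)); first exact: grid_point_le.
by apply: known_state => [|y]; [exact: inp | exact: (known_phi y (inp ik))].
Qed.

Let S_le j w : (j <= k.+1)%N -> `|S j w| <= h.
Proof.
move=> jk; rewrite normrM gtr0_norm //.
apply: le_trans (_ : delta * j%:R <= _).
  rewrite ler_pM2l //; apply: le_trans (ler_norm_sum _ _ _) _.
  apply: le_trans (_ : \sum_(i < j) 1 <= _); last by rewrite sumr_const card_ord.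
  by apply: ler_sum => i _; exact: centered_le1.
by rewrite /delta mulrAC ler_pdivrMr // ler_pM2l // ler_nat.
Qed.

Let S_bounded j : (j <= k.+1)%N -> bounded_mfun (S j).
Proof. by move=> jk; apply: (known_bounded hZ (S_known jk)) => w; exact: S_le. Qed.

Let g_bounded j : (j <= k.+1)%N -> bounded_mfun (fun w => g w (Z n (s j) w)).
Proof.
move=> jk; have ns := inp jk.
have kg : known (s j) (fun w => g w (Z n (s j) w)).
  by apply: known_state => // y; exact: known_g.
by apply: (known_bounded hZ kg) => w; exact: g_le.
Qed.

Let f_bounded j : (j <= k.+1)%N -> bounded_mfun (f j).
Proof.
move=> jk; have ns := inp jk.
have kf : known (s j) (f j).
  by apply: known_state => // y; exact: known_phi.
by apply: (known_bounded hZ kf) => w; exact: phi_le.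
Qed.

Let L j w := S j w * S j w - 2 * (S j w * g w (Z n (s j) w)).

Let L_bounded j : (j <= k.+1)%N -> bounded_mfun (L j).
Proof.
move=> jk; apply: bounded_mfunB; first exact: (bounded_mfunM (S_bounded jk) (S_bounded jk)).
apply: bounded_mfunM; first exact: bounded_mfun_cst.
exact: (bounded_mfunM (S_bounded jk) (g_bounded jk)).
Qed.

Let cost := 2 * (h * (delta ^+ 2 * C)) + (delta ^+ 2 + 2 * delta * V).

(** Writing [f j] for [phi] at the [j]-th grid point, [L (j + 1) - L j] equals
[- 2 S j (g_(j+1) - g_j - delta f j)], which has mean [O(delta ^ 2)], plus
[delta ^ 2 f j ^ 2 - 2 delta f j g_(j+1)], which is [O(delta)] pointwise. *)
Lemma lyapunov_growth j : (j <= k.+1)%N -> E (L j) <= j%:R * cost.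
Proof.
elim: j => [|j IH] jk.
  rewrite mul0r (_ : L 0 = fun=> 0); first by rewrite /E Ex_cst.
  by apply/funext => w; rewrite /L /S big_ord0 !mulr0 !mul0r mulr0 subr0.
have jk' := ltnW jk.
rewrite -natr1 mulrDl mul1r.
pose inc w := S j w * (g w (Z n (s j.+1) w) - g w (Z n (s j) w) - (s j.+1 - s j) * f j w).
pose rem w := delta ^+ 2 * (f j w * f j w) - 2 * delta * (f j w * g w (Z n (s j.+1) w)).
have sS : s j.+1 - s j = delta by rewrite /s grid_pointS addrAC subrr add0r.
have LS : L j.+1 = fun w => (L j w - 2 * inc w) + rem w.
  apply/funext => w; rewrite /L /inc /rem sS /S big_ord_recr /=; ring.
have binc : bounded_mfun inc.
  apply: bounded_mfunM; first exact: S_bounded.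
  apply: bounded_mfunB; first by apply: bounded_mfunB; exact: g_bounded.
  by apply: bounded_mfunM; [exact: bounded_mfun_cst | exact: f_bounded].
have bcst (c : R) (v : T -> R) : bounded_mfun v -> bounded_mfun (fun w => c * v w).
  by move=> bv; apply: bounded_mfunM => //; exact: bounded_mfun_cst.
have brem : bounded_mfun rem.
  apply: bounded_mfunB; apply: bcst.
    exact: (bounded_mfunM (f_bounded jk') (f_bounded jk')).
  exact: (bounded_mfunM (f_bounded jk') (g_bounded jk)).
rewrite LS /E ExD //; last by apply: bounded_mfunB; [exact: L_bounded | exact: bcst].
rewrite ExB ?ExZ //; [|exact: L_bounded|exact: bcst].
have inc_le : `|Ex P inc| <= h * (delta ^+ 2 * C).
  rewrite /C -sS; apply: potential_increment.
  - exact: inp.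
  - exact: inp.
  - exact: grid_point_le.
  - by rewrite sS.
  - exact: S_known.
  - by move=> w; exact: S_le.
have rem_le : Ex P rem <= delta ^+ 2 + 2 * delta * V.
  apply: Ex_le_cst => // w; rewrite /rem.
  have f1 := centered_le1 A b x (Rn n w) (Z n (s j) w).
  have gV := potential_le w (Z n (s j.+1) w).
  rewrite lerD //.
    rewrite ler_piMr ?sqr_ge0 // (le_trans (ler_norm _)) // normrM -[leRHS]mul1r.
    by rewrite ler_pM.
  rewrite -mulrN ler_pM2l ?mulr_gt0 // (le_trans (ler_norm _)) // normrN normrM.
  by rewrite -[V]mul1r ler_pM.
have := IH jk'; rewrite /cost /E; move: inc_le; rewrite ler_norml => /andP[inc_lo _].
by move: rem_le inc_lo; lra.
Qed.

Lemma grid_variance :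
  E (fun w => (state_mean t Z n x k w - product_form A b (Rn n w) x 0) ^+ 2) <=
  (2 * C + h^-1) * delta + 4 * V / h.
Proof.
have meanE w : state_mean t Z n x k w - product_form A b (Rn n w) x 0 =
    h^-1 * S k.+1 w.
  rewrite /S /delta mulrA mulKf ?gt_eqF // /f /phi /state_mean.
  under [in RHS]eq_bigr do rewrite mxE.
  by rewrite sumrB sumr_const card_ord mulrBr -(mulr_natl (product_form A b (Rn n w) x 0)) mulKf // pnatr_eq0.
have -> : (fun w => (state_mean t Z n x k w - product_form A b (Rn n w) x 0) ^+ 2) =
    (fun w => h^-1 ^+ 2 * (L k.+1 w + 2 * (S k.+1 w * g w (Z n (s k.+1) w)))).
  by apply/funext => w; rewrite meanE /L; ring.
have bSg : bounded_mfun (fun w => S k.+1 w * g w (Z n (s k.+1) w)).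
  exact: (bounded_mfunM (S_bounded (leqnn _)) (g_bounded (leqnn _))).
have b2 : bounded_mfun (fun w => 2 * (S k.+1 w * g w (Z n (s k.+1) w))).
  by apply: bounded_mfunM => //; exact: bounded_mfun_cst.
have bL := L_bounded (leqnn k.+1).
rewrite /E ExZ; last exact: bounded_mfunD.
rewrite ExD // ExZ //.
have le1 := lyapunov_growth (leqnn k.+1).
have le2 : Ex P (fun w => S k.+1 w * g w (Z n (s k.+1) w)) <= h * V.
  apply: Ex_le_cst => // w; rewrite (le_trans (ler_norm _)) // normrM.
  by rewrite ler_pM // S_le.
have -> : (2 * C + h^-1) * delta + 4 * V / h =
    h^-1 ^+ 2 * (k.+1%:R * cost + 2 * (h * V)).
  have kd : k.+1%:R * delta = h by rewrite /delta mulrC divfK.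
  have -> : k.+1%:R * cost = h * (2 * h * delta * C + delta + 2 * V).
    by rewrite -{1}kd /cost; ring.
  by field; rewrite gt_eqF.
by rewrite ler_wpM2l ?exprn_ge0 ?invr_ge0 ?(ltW h0) // lerD // ler_pM2l.
Qed.

End Grid.

(** Refining the grid removes the discretisation error of [grid_variance]. *)
Lemma occupation_variance :
  E (fun w => (occupation t Z n w x 0 - product_form A b (Rn n w) x 0) ^+ 2) <=
  4 * V / h.
Proof.
have tn : t n < t n.+1 by case: ht.
pose f k w := (state_mean t Z n x k w - product_form A b (Rn n w) x 0) ^+ 2.
have mpi : measurable_fun setT (fun w => product_form A b (Rn n w) x 0).
  have ns : in_period t n (t n) by rewrite /in_period lexx ltW.
  apply: (determined_by_measurable (observed_measurable hZ (n := n) (s := t n))).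
  exact: (product_form_measurable A b (mRn ns) x 0).
have mstate k : measurable_fun setT (state_mean t Z n x k).
  exact: (determined_by_measurable (observed_measurable hZ (n := n) (s := t n.+1))
    (state_mean_determined ht x k (leqnn n) (lexx _))).
have f1 k w : `|f k w| <= 1.
  rewrite /f normrX exprn_ile1 //.
  have p0 := ltW (product_form_gt0 A b (Rn n w) x); have p1 := product_form_le1 A b (Rn n w) x.
  have /andP[m0 m1] := state_mean_bounds t Z n x k w.
  by rewrite ler_norml; apply/andP; split; lra.
have cvE : E (f k) @[k --> \oo] -->
    E (fun w => (occupation t Z n w x 0 - product_form A b (Rn n w) x 0) ^+ 2).
  apply: (Ex_cvg _ (M := 1)) => // [k|w].
    by apply: measurable_funX; exact: measurable_funB.
  rewrite /f; under eq_fun do rewrite expr2; rewrite expr2.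
  have cv : state_mean t Z n x k w - product_form A b (Rn n w) x 0 @[k --> \oo] -->
      occupation t Z n w x 0 - product_form A b (Rn n w) x 0.
    by apply: cvgB; [exact: (occupation_cvg ht hZ) | exact: cvg_cst].
  exact: (cvgM cv cv).
have cvd : h / k.+1%:R @[k --> \oo] --> (0 : R).
  by rewrite -[X in _ --> X](mulr0 h); apply: cvgM; [exact: cvg_cst | exact: cvg_harmonic].
have cvb : (2 * C + h^-1) * (h / k.+1%:R) + 4 * V / h @[k --> \oo] --> 4 * V / h.
  rewrite -[X in _ --> X]add0r -(mulr0 (2 * C + h^-1)).
  by apply: cvgD; [apply: cvgM => //; exact: cvg_cst | exact: cvg_cst].
apply: (ler_cvg_to cvE cvb).
have : \forall k \near \oo, h / k.+1%:R < 1 by move/cvgr_lt : cvd; apply.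
by apply: filterS => k /ltW; exact: grid_variance.
Qed.

End OccupationVariance.

(** * Almost sure convergence *)

Lemma nneseries_partial_bounded (R : realType) (u : nat -> R) (m : nat) :
  (forall n, (m <= n)%N -> 0 <= u n) ->
  (\sum_(m <= n <oo) (u n)%:E < +oo)%E ->
  exists M : R, forall n, \sum_(m <= i < n) u i <= M.
Proof.
move=> u0 sumu.
have u0E n : (m <= n)%N -> xpredT n -> (0 <= (u n)%:E)%E.
  by move=> mn _; rewrite lee_fin u0.
exists (fine (\sum_(m <= n <oo) (u n)%:E)%E) => n.
rewrite -lee_fin fineK; last by rewrite ge0_fin_numE //; exact: nneseries_ge0.
by rewrite -sumEFin; exact: nneseries_lim_ge.
Qed.

Lemma nneseries_partial_unbounded (R : realType) (u : nat -> R) (m : nat) :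
  (forall n, (m <= n)%N -> 0 <= u n) ->
  (\sum_(m <= n <oo) (u n)%:E = +oo)%E ->
  forall K, exists n, K < \sum_(m <= i < n) u i.
Proof.
move=> u0 sumu K; apply: contrapT => no.
have : (\sum_(m <= n <oo) (u n)%:E <= K%:E)%E.
  apply: lime_le.
    by apply: is_cvg_nneseries => n mn _; rewrite lee_fin u0.
  apply: nearW => n; rewrite sumEFin lee_fin leNgt.
  by apply/negP => Kn; apply: no; exists n.
by rewrite sumu leye_eq.
Qed.

Lemma ae_bounded_partial_sums (R : realType) disp (T : measurableType disp)
    (P : probability T R) (F : nat -> T -> R) (M : R) :
  (forall n, bounded_mfun (F n)) -> (forall n w, 0 <= F n w) ->
  (forall n, \sum_(i < n) Ex P (F i) <= M) ->
  {ae P, forall w, exists K : R, forall n, \sum_(i < n) F i w <= K}.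
Proof.
move=> bF F0 sumF.
pose G w : \bar R := (\sum_(n <oo) (F n w)%:E)%E.
have mF n : measurable_fun setT (fun w => (F n w)%:E).
  by apply/measurable_EFinP; case: (bF n).
have FE0 n w : (0 <= (F n w)%:E)%E by rewrite lee_fin.
have G0 w : (0 <= G w)%E by apply: nneseries_ge0 => n _ _; exact: FE0.
have mG : measurable_fun setT G.
  by apply: ge0_emeasurable_sum => [k w _ _|k _]; [exact: FE0 | exact: mF].
have intG : (\int[P]_w G w <= M%:E)%E.
  rewrite /G integral_nneseries //.
  apply: lime_le.
    by apply: is_cvg_nneseries => n _ _; apply: integral_ge0 => w _; exact: FE0.
  apply: nearW => n; rewrite big_mkord.
  rewrite (eq_bigr (fun i : 'I_n => (Ex P (F i))%:E)).
    rewrite sumEFin lee_fin; exact: sumF.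
  move=> i _; rewrite /Ex /Rintegral fineK //.
  exact/integrable_fin_num/bounded_mfun_integrable.
have iG : P.-integrable setT G.
  apply/integrableP; split => //.
  under eq_integral do rewrite gee0_abs ?G0 //.
  by rewrite (le_lt_trans intG) // ltry.
apply: filterS (integrable_ae measurableT iG) => w /(_ I) fG.
have [|K FK] := @nneseries_partial_bounded _ (F ^~ w) 0 (fun n _ => F0 n w).
  by move: fG; rewrite ge0_fin_numE.
by exists K => n; rewrite -(big_mkord xpredT (F ^~ w)).
Qed.

Section OnlineConvergence.
Context {R : realType} {N d : nat} {disp : measure_display}
  {T : measurableType disp}.
Variables (A : 'M[R]_(N, d)) (b : 'cV[R]_N) (Q : 'cV[R]_d -> 'M[R]_N)
  (hQ : product_form_network A b Q) (gamma : 'cV[R]_d)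
  (P : probability T R) (t : nat -> R) (ht : observation_times t)
  (a : nat -> R) (ha : forall n, (0 < n)%N -> 0 < a n)
  (X0 : T -> 'I_N) (Z : nat -> R -> T -> 'I_N)
  (r0 : 'cV[R]_d) (Rn : nat -> T -> 'cV[R]_d)
  (hZ : online_process P t Q X0 Z Rn)
  (hRn : online_algorithm t A gamma r0 a Z Rn).

Definition estimation_error n x w : R :=
  occupation t Z n w x 0 - product_form A b (Rn n w) x 0.

Let S n := \sum_(1 <= m < n.+1) a m.

Let S_ge0 n : 0 <= S n.
Proof. by rewrite /S big_nat; apply: sumr_ge0 => m /andP[m1 _]; exact/ltW/ha. Qed.

Let S_recr n : S n.+1 = S n + a n.+1.
Proof. by rewrite /S big_nat_recr. Qed.

Lemma estimation_error_le1 n x w : `|estimation_error n x w| <= 1.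
Proof.
have p0 := ltW (product_form_gt0 A b (Rn n w) x).
have p1 := product_form_le1 A b (Rn n w) x.
have /andP[u0 u1] := occupation_bounds ht hZ n w x.
by rewrite /estimation_error ler_norml; apply/andP; split; lra.
Qed.

Lemma estimation_error_bounded n x : bounded_mfun (estimation_error n x).
Proof.
split; last by exists 1 => w; exact: estimation_error_le1.
have tn : t n <= t n.+1 by rewrite ltW //; case: ht.
have ns : in_period t n (t n.+1) by rewrite /in_period lexx tn.
apply: (determined_by_measurable (observed_measurable hZ (n := n) (s := t n.+1))).
apply: measurable_funB; first exact: (occupation_determined ht hZ x (leqnn n) (lexx _)).
exact: (product_form_measurable A b (iterate_determined_later ht hZ hRn ns) x 0).
Qed.

(** The exponent [c4] exceeds the growth rate [c kap] of the variance bound, so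
that [exp (- c4 S)] absorbs it.  The two cases of the proof compare the variance
bound with [e ^ 2]. *)
Lemma estimation_error_L1 (x : 'I_N) : exists K c4 : R, [/\ 0 < K, 0 < c4 &
  forall n (e : R), 0 <= e -> Ex P (fun w => `|estimation_error n x w|) <=
    K * (e + expR (1 * S n.+1 -
                   1 * (e ^+ 2 / frequency t n.+1) * expR (- c4 * S n.+1)))].
Proof.
have [C [c [C0 c0 growth]]] := deviation_growth hQ.
pose kap : R := max_increment A gamma.
have kap0 : 0 <= kap by exact: max_increment_ge0.
pose L : R := 4 * (C * expR (c * norm1 r0)).
have L0 : 0 < L by rewrite !mulr_gt0 ?expR_gt0.
exists (expR L), (c * kap + 1).
split; [exact: expR_gt0 | by rewrite ltr_wpDl ?mulr_ge0 ?(ltW c0) |].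
move=> n e e0.
pose B : R := norm1 r0 + kap * S n.
have RB w : norm1 (Rn n w) <= B by exact: (iterate_norm1 ht hZ hRn ha n w).
have [q Qq] := generator_entry_bounded hQ B.
pose V : R := C * expR (c * B).
have V0 : 0 < V by rewrite mulr_gt0 ?expR_gt0.
have potV w z : `|potential A b Q x (Rn n w) z 0| <= V.
  apply: le_trans (growth (Rn n w) _ (centered_mean A b x _) _ z) _.
    exact: centered_le1.
  by rewrite ler_pM2l // ler_expR ler_pM2l.
have var := occupation_variance hQ ht hZ hRn (fun w => Qq _ (RB w)) potV.
have tn : 0 < t n.+1 - t n by rewrite subr_gt0; case: ht.
set f := frequency t n.+1.
have fE : f = (t n.+1 - t n)^-1 by [].
have f0 : 0 < f by rewrite fE invr_gt0.
have {}var : Ex P (fun w => estimation_error n x w ^+ 2) <= 4 * V * f by [].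
set E := expR (1 * _ - _).
have E0 : 0 < E by exact: expR_gt0.
have bE := estimation_error_bounded n x.
have bA : bounded_mfun (fun w => `|estimation_error n x w|).
  split; last by exists 1 => w; rewrite normr_id; exact: estimation_error_le1.
  by apply: measurableT_comp => //; case: bE.
have bE2 : bounded_mfun (fun w => estimation_error n x w ^+ 2).
  by under eq_fun do rewrite expr2; exact: (bounded_mfunM bE bE).
have [ve|ev] := leP (4 * V * f) (e ^+ 2).
  have e_gt0 : 0 < e.
    rewrite lt_def e0 andbT -sqrf_eq0 gt_eqF //.
    by apply: lt_le_trans ve; rewrite mulr_gt0 // mulr_gt0.
  (* |y| <= e / 2 + y ^ 2 / (2 e), whose mean is at most e. *)
  have amgm w : `|estimation_error n x w| <=
      e / 2 + (2 * e)^-1 * estimation_error n x w ^+ 2.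
    rewrite -[in leRHS]real_normK ?num_real //.
    set y := `|_|; rewrite -subr_ge0.
    have -> : e / 2 + (2 * e)^-1 * y ^+ 2 - y = (2 * e)^-1 * (e - y) ^+ 2.
      by field; rewrite gt_eqF.
    by rewrite mulr_ge0 ?sqr_ge0 // invr_ge0 mulr_ge0.
  have bR : bounded_mfun (fun w => (2 * e)^-1 * estimation_error n x w ^+ 2).
    by apply: bounded_mfunM => //; exact: bounded_mfun_cst.
  apply: le_trans (Ex_le P bA (bounded_mfunD (bounded_mfun_cst _) bR) amgm) _.
  rewrite ExD ?Ex_cst ?ExZ //; last exact: bounded_mfun_cst.
  apply: le_trans (_ : e <= _).
    apply: le_trans (_ : e / 2 + (2 * e)^-1 * e ^+ 2 <= _).
      by rewrite lerD2l ler_wpM2l ?invr_ge0 ?mulr_ge0 // (le_trans var).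
    by rewrite le_eqVlt; apply/orP; left; apply/eqP; field; rewrite gt_eqF.
  apply: le_trans (_ : 1 * (e + E) <= _).
    by rewrite mul1r lerDl ltW.
  by rewrite ler_wpM2r ?addr_ge0 ?(ltW E0) // -expR0 ler_expR ltW.
(* Here the exponent is at least - L, so the exponential absorbs the bound 1. *)
apply: le_trans (_ : 1 <= _).
  by apply: Ex_le_cst => // w; exact: estimation_error_le1.
apply: le_trans (_ : expR L * E <= _); last first.
  by rewrite ler_pM2l ?expR_gt0 // lerDr.
rewrite /E -expRD -[leLHS]expR0 ler_expR !mul1r.
have le1 : e ^+ 2 / f * expR (- (c * kap + 1) * S n.+1) <= L.
  apply: le_trans (_ : 4 * V * expR (- (c * kap + 1) * S n.+1) <= _).
    by rewrite ler_wpM2r ?expR_ge0 // ler_pdivrMr // ltW.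
  rewrite /V /L -!mulrA !ler_pM2l // -expRD ler_expR /B.
  have := S_recr n; have := ha (ltn0Sn n); have := S_ge0 n.
  have ck0 : 0 <= c * kap by rewrite mulr_ge0 // ltW.
  by move: ck0; set ck := c * kap => ck0 S0 a0 ->; rewrite mulrDr mulrA -/ck; nra.
by have := S_ge0 n.+1; move: le1; lra.
Qed.

(** Expanding the square of [Rn - ropt - a D], where [D] is the exact gradient
plus [A^T] applied to the estimation errors; the cross term with the errors
carries the factor [|Rn - ropt|], which grows at most like [1 + S n]. *)
Lemma descent_step (ropt : 'cV[R]_d) : exists c : R, 0 <= c /\ forall n w,
  \sum_i (Rn n.+1 w - ropt) i 0 ^+ 2 <=
  \sum_i (Rn n w - ropt) i 0 ^+ 2 -
  2 * a n.+1 * (\sum_i (Rn n w - ropt) i 0 *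
     (A^T *m product_form A b (Rn n w) - gamma) i 0) +
  (c * (a n.+1 * (1 + S n) * \sum_x `|estimation_error n x w|) + c * a n.+1 ^+ 2).
Proof.
pose kap : R := max_increment A gamma.
have kap0 : 0 <= kap by exact: max_increment_ge0.
pose Am : R := \sum_x \sum_i `|A x i|.
have Am0 : 0 <= Am by apply: sumr_ge0 => x _; apply: sumr_ge0.
have Ale x i : `|A x i| <= Am.
  rewrite /Am (bigD1 x) //= (bigD1 i) //= -addrA lerDl.
  by rewrite addr_ge0 ?sumr_ge0 // => y _; rewrite sumr_ge0.
pose r1 : R := norm1 r0 + kap + norm1 ropt.
have r10 : 0 <= r1 by rewrite !addr_ge0 ?norm1_ge0.
exists (2 * r1 * Am + kap ^+ 2); split.
  by rewrite addr_ge0 ?sqr_ge0 // !mulr_ge0.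
move=> n w.
set u := Rn n w - ropt.
pose D := A^T *m occupation t Z n w - gamma.
pose h := A^T *m product_form A b (Rn n w) - gamma.
pose W : R := \sum_x `|estimation_error n x w|.
have W0 : 0 <= W by exact: sumr_ge0.
have an := ha (ltn0Sn n).
have nextE i : (Rn n.+1 w - ropt) i 0 = u i 0 - a n.+1 * D i 0.
  by rewrite hRn.2 -/D /u !mxE addrAC.
have u1 : norm1 u <= r1 * (1 + S n).
  apply: le_trans (_ : norm1 (Rn n w) + norm1 ropt <= _).
    rewrite /norm1 -big_split; apply: ler_sum => i _ /=.
    by rewrite /u !mxE ler_normB.
  have := iterate_norm1 ht hZ hRn ha n w; rewrite -/(S n) -/kap /r1.
  have := norm1_ge0 r0; have := norm1_ge0 ropt; have := S_ge0 n; nra.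
have Dsq : \sum_i D i 0 ^+ 2 <= kap ^+ 2.
  have nD : norm1 D <= kap by exact: (increment_norm1 A gamma ht hZ n w).
  apply: le_trans (_ : norm1 D ^+ 2 <= _); last first.
    by rewrite ler_sqr ?nnegrE ?norm1_ge0.
  rewrite [leRHS]expr2 {1}/norm1 mulr_suml; apply: ler_sum => i _.
  by rewrite -real_normK ?num_real // expr2 ler_wpM2l // coord_le_norm1.
have cross : - (\sum_i u i 0 * D i 0) <= - (\sum_i u i 0 * h i 0) + r1 * (1 + S n) * (Am * W).
  have DhE i : D i 0 = h i 0 + \sum_x A x i * estimation_error n x w.
    rewrite /D /h ![(_ - gamma) i 0]mxE addrAC; congr (_ + _).
    rewrite ![(A^T *m _) i 0]mxE -big_split; apply: eq_bigr => x _ /=.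
    by rewrite ![A^T i x]mxE /estimation_error; ring.
  have -> : \sum_i u i 0 * D i 0 = \sum_i u i 0 * h i 0 +
      \sum_i u i 0 * \sum_x A x i * estimation_error n x w.
    by rewrite -big_split; apply: eq_bigr => i _ /=; rewrite DhE mulrDr.
  rewrite opprD lerD2l; apply: le_trans (ler_norm _) _; rewrite normrN.
  apply: le_trans (_ : norm1 u * (Am * W) <= _); last first.
    by rewrite ler_wpM2r // mulr_ge0.
  apply: le_trans (ler_norm_sum _ _ _) _; rewrite /norm1 mulr_suml.
  apply: ler_sum => i _; rewrite normrM ler_wpM2l //.
  apply: le_trans (ler_norm_sum _ _ _) _; rewrite /W mulr_sumr.
  by apply: ler_sum => x _; rewrite normrM ler_wpM2r.
have -> : \sum_i (Rn n.+1 w - ropt) i 0 ^+ 2 =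
    \sum_i u i 0 ^+ 2 - 2 * a n.+1 * (\sum_i u i 0 * D i 0) +
    a n.+1 ^+ 2 * \sum_i D i 0 ^+ 2.
  rewrite !mulr_sumr -sumrB -big_split; apply: eq_bigr => i _ /=.
  by rewrite nextE; ring.
rewrite -/h -/W.
have c1 : a n.+1 * - (\sum_i u i 0 * D i 0) <=
    a n.+1 * (- (\sum_i u i 0 * h i 0) + r1 * (1 + S n) * (Am * W)).
  by rewrite ler_pM2l.
have c2 : a n.+1 ^+ 2 * \sum_i D i 0 ^+ 2 <= a n.+1 ^+ 2 * kap ^+ 2.
  by rewrite ler_wpM2l ?sqr_ge0.
have X0' : 0 <= kap ^+ 2 * (a n.+1 * (1 + S n) * W).
  by rewrite !mulr_ge0 ?sqr_ge0 ?(ltW an) // addr_ge0.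
have Y0 : 0 <= 2 * r1 * Am * a n.+1 ^+ 2.
  by apply: mulr_ge0 (sqr_ge0 _); apply: mulr_ge0 => //; exact: mulr_ge0.
have := lerD (ler_wpM2l (ler0n _ 2) c1) c2.
set sD := \sum_i u i 0 * D i 0; set sh := \sum_i u i 0 * h i 0.
set su := \sum_i u i 0 ^+ 2; set sDD := \sum_i D i 0 ^+ 2.
move=> H; rewrite -subr_ge0 in H; rewrite -subr_ge0.
rewrite (_ : _ - _ = 2 * (a n.+1 * (- sh + r1 * (1 + S n) * (Am * W))) +
  a n.+1 ^+ 2 * kap ^+ 2 - (2 * (a n.+1 * - sD) + a n.+1 ^+ 2 * sDD) +
  kap ^+ 2 * (a n.+1 * (1 + S n) * W) + 2 * r1 * Am * a n.+1 ^+ 2); last by ring.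
by apply: addr_ge0 Y0; exact: addr_ge0 H X0'.
Qed.

End OnlineConvergence.

Unset Implicit Arguments.

Theorem theorem2 (R : realType) (N d : nat) (hd : (0 < d)%N)
  (A : 'M[R]_(N, d)) (b : 'cV[R]_N) (Q : 'cV[R]_d -> 'M[R]_N)
  (hQ : product_form_network A b Q)
  (gamma : 'cV[R]_d) (hgamma : target_set A gamma)
  (alpha : 'cV[R]_N) (halpha : target_weights A gamma alpha)
  (ropt : 'cV[R]_d)
  (hopt : critical_point (objective A b alpha) ropt)
  (hopt_unique : forall r, critical_point (objective A b alpha) r -> r = ropt)
  (disp : measure_display) (T : measurableType disp) (P : probability T R)
  (t : nat -> R) (ht : observation_times t)
  (a : nat -> R) (ha : forall n, (0 < n)%N -> 0 < a n)
  (X0 : T -> 'I_N) (Z : nat -> R -> T -> 'I_N)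
  (r0 : 'cV[R]_d) (Rn : nat -> T -> 'cV[R]_d)
  (hZ : online_process P t Q X0 Z Rn)
  (hRn : online_algorithm t A gamma r0 a Z Rn)
  (e : nat -> R) (he : forall n, (0 < n)%N -> 0 <= e n)
  (ha_sum : (\sum_(1 <= n <oo) (a n)%:E = +oo)%E)
  (ha_sum_sq : (\sum_(1 <= n <oo) (a n ^+ 2)%:E < +oo)%E)
  (hsum : forall c2 c3 c4 : R, 0 < c2 -> 0 < c3 -> 0 < c4 ->
    (\sum_(1 <= n <oo)
      (a n * (\sum_(1 <= m < n) a m) *
       (e n + expR (c2 * (\sum_(1 <= m < n.+1) a m)
                    - c3 * (e n ^+ 2 / frequency t n)
                         * expR (- c4 * (\sum_(1 <= m < n.+1) a m)))))%:E
     < +oo)%E) :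
  {ae P, forall w, Rn n w @[n --> \oo] --> ropt}.
Proof.
have x0 : 'I_N := X0 point.
pose S n := \sum_(1 <= m < n.+1) a m.
have S_ge0 n : 0 <= S n.
  by rewrite /S big_nat; apply: sumr_ge0 => m /andP[m1 _]; exact/ltW/ha.
have S_mono n : S n <= S n.+1.
  by rewrite /S [leRHS]big_nat_recr //= lerDl; exact/ltW/ha.
pose err n x w := estimation_error A b t Z Rn n x w.
have berr n x : bounded_mfun (fun w => `|err n x w|).
  have [merr [M errM]] := estimation_error_bounded b ht hZ hRn n x.
  split; first exact: measurableT_comp.
  by exists M => w; rewrite normr_id.
pose F n w := a n.+1 * (1 + S n) * \sum_x `|err n x w|.
have wgt0 n : 0 <= a n.+1 * (1 + S n) by rewrite mulr_ge0 ?addr_ge0 // ltW // ha.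
have bsum n : bounded_mfun (fun w => \sum_x `|err n x w|).
  by apply: bounded_mfun_sum => x; exact: berr.
have bF n : bounded_mfun (F n) by apply: bounded_mfunM => //; exact: bounded_mfun_cst.
have F0 n w : 0 <= F n w by rewrite mulr_ge0 // sumr_ge0.
have [M1 sumExF] : exists M : R, forall n, \sum_(i < n) Ex P (F i) <= M.
  have ExF n : Ex P (F n) = \sum_x a n.+1 * (1 + S n) * Ex P (fun w => `|err n x w|).
    by rewrite /F ExZ // Ex_sum // mulr_sumr.
  suff bx x : exists M : R, forall n,
      \sum_(i < n) a i.+1 * (1 + S i) * Ex P (fun w => `|err i x w|) <= M.
    have /choice[Mx MxP] := bx.
    exists (\sum_x Mx x) => n; under eq_bigr do rewrite ExF.
    by rewrite exchange_big /=; apply: ler_sum => x _; exact: MxP.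
  have [K [c4 [K0 c40 L1]]] := estimation_error_L1 hQ ht ha hZ hRn x.
  have := hsum 1 1 c4 ltr01 ltr01 c40.
  move=> /nneseries_partial_bounded[n n1|M MP].
    rewrite !mulr_ge0 ?addr_ge0 ?expR_ge0 ?he ?(ltW (ha n n1)) //.
    by rewrite big_nat; apply: sumr_ge0 => m /andP[m1 _]; exact/ltW/ha.
  pose term n := e n + expR (1 * S n - 1 * (e n ^+ 2 / frequency t n) * expR (- c4 * S n)).
  have term0 n : (0 < n)%N -> 0 <= term n by move=> n0; rewrite addr_ge0 ?expR_ge0 ?he.
  have L1' n : Ex P (fun w => `|err n x w|) <= K * term n.+1 by exact: L1 (he _ (ltn0Sn n)).
  have a1 := ha 1%N isT.
  (* For n >= 1 the sum S n is at least a 1, so 1 + S n is at most a multiple of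
     S n; the term n = 0, for which S 0 = 0, is treated apart. *)
  pose k1 := 1 + (a 1%N)^-1.
  have S1 n : (0 < n)%N -> 1 + S n <= k1 * S n.
    move=> n0; rewrite /k1 mulrDl mul1r addrC lerD2l mulrC ler_pdivlMr // mul1r.
    case: n n0 => // n _; elim: n => [|n IH]; first by rewrite /S big_nat1.
    exact: le_trans (S_mono _).
  pose h0 := a 1%N * (1 + S 0%N) * (K * term 1%N).
  have h00 : 0 <= h0 := mulr_ge0 (wgt0 0%N) (mulr_ge0 (ltW K0) (term0 1%N isT)).
  exists (h0 + K * k1 * M) => n.
  have M0 : 0 <= M by have := MP 0%N; rewrite big_geq.
  have k10 : 0 <= k1 by rewrite addr_ge0 // invr_ge0 ltW.
  case: n => [|n].
    by rewrite big_ord0 addr_ge0 // mulr_ge0 // mulr_ge0 // ltW.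
  rewrite big_ord_recl lerD //; first by rewrite ler_wpM2l.
  have := MP n.+2; rewrite big_nat_recl //= => MPn.
  apply: le_trans (_ : K * k1 * (\sum_(1 <= i < n.+1)
    a i.+1 * S i * term i.+1) <= _); last first.
    rewrite ler_wpM2l ?mulr_ge0 ?(ltW K0) //; apply: le_trans MPn.
    rewrite [X in _ <= X + _](_ : _ = 0); last by rewrite [X in _ * X * _]big_geq // mulr0 mul0r.
    by rewrite add0r.
  rewrite big_add1 /= big_mkord mulr_sumr; apply: ler_sum => i _.
  rewrite /bump /= add1n.
  have -> : K * k1 * (a i.+2 * S i.+1 * term i.+2) =
      a i.+2 * (k1 * S i.+1) * (K * term i.+2) by ring.
  apply: ler_pM => //.
  - by apply: (Ex_ge0 P) => w.
  - by rewrite ler_pM2l ?ha // S1.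
have [M2 sumsq] := nneseries_partial_bounded (fun n _ => sqr_ge0 (a n)) ha_sum_sq.
have unb := nneseries_partial_unbounded (fun n n1 => ltW (ha n n1)) ha_sum.
have [c [c0 step]] := descent_step b ht ha hZ hRn ropt.
have [drift0 coercive] := mean_drift_coercive x0 halpha hopt hopt_unique.
apply: filterS (ae_bounded_partial_sums bF F0 sumExF) => w [Kw sumFw].
pose D n := \sum_i (Rn n w - ropt) i 0 ^+ 2.
have D0 : D n @[n --> \oo] --> 0.
  apply: (@perturbed_descent_cvg0 R D (fun n => 2 * a n.+1)
    (fun n => \sum_i (Rn n w - ropt) i 0 *
       (A^T *m product_form A b (Rn n w) - gamma) i 0)
    (fun n => c * F n w + c * a n.+1 ^+ 2) (c * Kw + c * M2)).
  - by move=> n; apply: sumr_ge0 => i _; exact: sqr_ge0.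
  - by move=> n; rewrite mulr_ge0 // ltW // ha.
  - by move=> n; rewrite addr_ge0 // mulr_ge0 ?sqr_ge0.
  - by move=> n; exact: drift0.
  - by move=> n; exact: step.
  - move=> B; have [k k0 kP] := coercive B; exists k => // n; exact: kP.
  - move=> n; rewrite big_split /= -!mulr_sumr.
    apply: lerD; apply: ler_wpM2l => //; first exact: sumFw.
    by have := sumsq n.+1; rewrite big_add1 /= big_mkord.
  - move=> K; have [n Kn] := unb (K / 2).
    exists n; rewrite -mulr_sumr mulrC -ltr_pdivrMr //; apply: lt_le_trans Kn _.
    case: n => [|n]; first by rewrite big_geq // big_ord0.
    rewrite big_add1 /= big_mkord big_ord_recr /= lerDl; exact/ltW/ha.
apply: cvg_mx_entries => i j; rewrite (ord1 j).
apply/cvgrPdist_lt => eps eps0.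
have eps2 : 0 < eps ^+ 2 by rewrite exprn_gt0.
move/cvgr_lt : D0 => /(_ _ eps2); apply: filterS => n Dn.
rewrite distrC -(ltr_pXn2r (n := 2)) ?nnegrE ?(ltW eps0) // real_normK ?num_real //.
apply: le_lt_trans Dn; rewrite /D (bigD1 i) //= !mxE lerDl.
by apply: sumr_ge0 => k _; exact: sqr_ge0.
Qed.
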